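(* Let $X(t),t\in\mathbb{Z}^d$, be a stationary max-stable rf with unit Fréchet marginals, spectral rf $Z$, spectral tail rf $\Theta$, and $Y=R\Theta$. Let $\mathcal I$ be an anchoring map with $P(\mathcal I(Y)\in\mathbb{Z}^d,\mathcal S(Y)<\infty)=P(\mathcal S(Y)<\infty)$. If $P(\mathcal S(\Theta)<\infty)>0$, then $$\theta_X=P(\mathcal I(Y)=0,\mathcal S(Y)<\infty)=P(\mathcal I_{fe}(Y)=0)=P(\mathcal I_A(\Theta)=0)=E\Big[\frac{\max_t\Theta(t)}{\sum_t\Theta(t)}\Big]=E\Big[Z(0)\frac{\max_tZ(t)}{\sum_tZ(t)}\Big]=E\Big[\frac1{\mathcal B(Y)}\Big],$$ and if moreover $\mathcal I$ is $0$-homogeneous then also $\theta_X=P(\mathcal I(\Theta)=0,\mathcal S(\Theta)<\infty)$. Furthermore, $\{\mathcal B(Y)<\infty\}=\{\mathcal S(Y)<\infty\}$ almost surely, and $\theta_X=1$ if and only if $\Theta(i)=0$ almost surely for every $i\in\mathbb{Z}^d\setminus\{0\}$. (The identity $\theta_X=E[1/\mathcal B(Y)]$ holds also without the assumption $P(\mathcal S(\Theta)<\infty)>0$.)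
   Context: $E=[0,\infty)^{\mathbb{Z}^d}$ with product $\sigma$-field; shift $(B^hf)(t)=f(t-h)$; $\mathcal S(f)=\sum_{t}f(t)$, $\mathcal B(f)=\sum_t\mathbf 1(f(t)>1)$; ratios $0/0$ and $\infty/\infty$ (and $c/\infty$) are interpreted as $0$, and $1/\infty=0$. A max-stable rf $X$ with unit Fréchet marginals has a spectral rf $Z$: non-negative, $E Z(t)=1$, $P(\sup_tZ(t)>0)=1$, with $-\ln P(X(t_i)\le x_i,i\le n)=E[\max_{i\le n}Z(t_i)/x_i]$. Its spectral tail rf $\Theta$ is given by $P(\Theta\in A)=E[Z(0)\mathbf 1(Z/Z(0)\in A)]$ ($\Theta(0)=1$ a.s.); $Y=R\Theta$ with $R$ unit Pareto ($P(R>x)=1/x$, $x\ge1$) independent of $\Theta$. Extremal index: $\theta_X=\lim_n n^{-d}E[\max_{t\in[0,n]^d\cap\mathbb{Z}^d}Z(t)]\in[0,1]$. Fix a translation-invariant total order on $\mathbb{Z}^d$ (minima below are with respect to it). An anchoring map is a measurable $\mathcal I:E\to\mathbb{Z}^d\cup\{\infty\}$ such that for all $f$ with $\mathcal I(f)\in\mathbb{Z}^d$ and all $i$: (i) $\mathcal I(f)=i$ implies $f(i)\ge\min(f(0),1)$; (ii) $\mathcal I(f)=\mathcal I(B^if)-i$. First maximum functional: $\mathcal I_A(f)=\min\{j:f(j)=\max_if(i)\}$ if $\mathcal S(f)<\infty$ and $\max_if(i)>0$, and $\mathcal I_A(f)=\infty$ otherwise. First exceedance functional: $\mathcal I_{fe}(f)=\min\{j:f(j)>1\}$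 if $\mathcal S(f)<\infty$ and $\max_if(i)>1$, and $\infty$ otherwise. $\mathcal I$ is 0-homogeneous if $\mathcal I(cf)=\mathcal I(f)$ for $c>0$. *)

(* Defs.v *)
From HB Require Import structures.
From mathcomp Require Import all_boot all_order all_algebra.
From mathcomp Require Import all_classical all_reals all_analysis.
Set Implicit Arguments. Unset Strict Implicit. Unset Printing Implicit Defensive.
Import Order.TTheory GRing.Theory Num.Theory.
Local Open Scope classical_set_scope.
Local Open Scope ring_scope.

Definition Zd (d : nat) := {ffun 'I_d -> int}.

Section Defs.
Context {R : realType} {d : nat}.

Definition inE (f : Zd d -> R) : Prop := forall t, 0 <= f t.

Definition Bshift (h : Zd d) (f : Zd d -> R) : Zd d -> R := fun t => f (t - h).

Definition cylinders : set (set (Zd d -> R)) :=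
  [set A | exists (t : Zd d) (B : set R), measurable B /\ A = [set f | B (f t)]].
Definition prodF : set (set (Zd d -> R)) := <<s cylinders >>.

Definition SS (f : Zd d -> R) : \bar R := (\esum_(t in [set: Zd d]) (f t)%:E)%E.
Definition BB (f : Zd d -> R) : \bar R :=
  (\esum_(t in [set: Zd d]) (if 1 < f t then 1 else 0 : R)%:E)%E.
Definition supf (f : Zd d -> R) : \bar R := ereal_sup [set (f t)%:E | t in [set: Zd d]].

(* ratio with the conventions 0/0 = 0, c/oo = 0 (in particular oo/oo = 0, 1/oo = 0) *)
Definition ediv (a b : \bar R) : \bar R :=
  match b with
  | r%:E => if r == 0 then 0%E else (a * (r^-1)%:E)%E
  | _ => 0%E
  end.

Definition ti_total_order (ord : rel (Zd d)) : Prop :=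
  [/\ reflexive ord, antisymmetric ord, transitive ord, total ord &
      forall x y h, ord x y = ord (x + h) (y + h)].

(* the minimum of a set w.r.t. ord (used only for nonempty finite sets) *)
Definition minset (ord : rel (Zd d)) (M : set (Zd d)) : Zd d :=
  xget 0 [set j | M j /\ forall k, M k -> ord j k].

(* first maximum functional I_A; None encodes the value oo *)
Definition I_A (ord : rel (Zd d)) (f : Zd d -> R) : option (Zd d) :=
  if pselect ((SS f < +oo)%E /\ (0 < supf f)%E)
  then Some (minset ord [set j | (f j)%:E = supf f]) else None.

Definition I_fe (ord : rel (Zd d)) (f : Zd d -> R) : option (Zd d) :=
  if pselect ((SS f < +oo)%E /\ (1 < supf f)%E)
  then Some (minset ord [set j | 1 < f j]) else None.

(* anchoring map (None encodes oo) *)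
Definition anchoring (I : (Zd d -> R) -> option (Zd d)) : Prop :=
  (forall j : option (Zd d), prodF (I @^-1` [set j])) /\
  (forall f, inE f -> I f <> None ->
     (forall i, I f = Some i -> Num.min (f 0) 1 <= f i) /\
     (forall i, I f = omap (fun k => k - i) (I (Bshift i f)))).

Definition zero_homogeneous (I : (Zd d -> R) -> option (Zd d)) : Prop :=
  forall f (c : R), inE f -> 0 < c -> I (fun t => c * f t) = I f.

Definition box (n : nat) : set (Zd d) :=
  [set t | forall k, 0 <= t k /\ t k <= n%:Z].

Definition extremal_index_is {dT : measure_display} {T : measurableType dT}
  (P : probability T R) (Z : T -> Zd d -> R) (th : \bar R) : Prop :=
  (fun n : nat => ((n%:R ^- d)%:E *
      \int[P]_w ereal_sup [set (Z w t)%:E | t in box n])%E) @ \oo --> th.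

End Defs.

(* Main.v *)
Require Import Defs.
From HB Require Import structures.
From mathcomp Require Import all_boot all_order all_algebra.
From mathcomp Require Import all_classical all_reals all_analysis.
Import Order.TTheory GRing.Theory Num.Theory.
Local Open Scope classical_set_scope.
Local Open Scope ring_scope.
From mathcomp Require Import measurable_realfun ring lra zify.
Import numFieldNormedType.Exports.
Set Implicit Arguments.
Unset Strict Implicit.
Unset Printing Implicit Defensive.

(* Write V(s) = E[max_{(t,x) in s} Z(t)/x]. Integrating out the Pareto radius
   gives P(Y(t_i) <= x_i for all i) = V((0,1), s) - V(s), and V is shift
   invariant because it is minus the logarithm of a distribution function of X.
   Expanding both sides, this yields the time-change formula
     P(Y in A, Y(h) > 1) = P(B^h Y in A, Y(-h) > 1),
   a mass-transport principle for the exceedance points of Y: if a functional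
   selects exactly one exceedance of every configuration with finitely many of
   them, the probability that it selects 0 is E[1/B(Y)]. All anchoring maps are
   of this kind. Transporting mass to the first maximum, which is 0-homogeneous,
   and integrating out the radius turns B(Y) into S(Theta); this shows that
   B(Y) < oo implies S(Y) < oo and gives the formula with max / sum. Finally
   E[max_box Z] telescopes, in the given order on Z^d, into the sum over t in
   the box of the probabilities that Y has no exceedance at the points u - t
   with u < t in the box, and all but a boundary proportion of these are close
   to the probability that 0 is the first exceedance of Y. *)

(** * Countable families *)

Section FiniteSubsums.
Import finmap.
Context {R : realFieldType} {I : choiceType}.
Local Open Scope ereal_scope.

Lemma esum_ereal_sup_fset (a : I -> \bar R) :
  \esum_(t in [set: I]) a t =
  ereal_sup [set \sum_(t <- enum_fset B) a t | B in [set: {fset I}]].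
Proof.
congr ereal_sup; apply/seteqP; split => [_ [A [finA _] <-]|_ [B _ <-]].
  by exists (fset_set A) => //; rewrite fsbig_finite.
by exists [set` B]; [split|rewrite fsbig_finite//= set_fsetK].
Qed.

End FiniteSubsums.

Section CountableIndex.
Context {R : realType} {I : countType} {d : measure_display}.
Context {T : measurableType d}.
Local Open Scope ereal_scope.

Lemma esum_pickle (a : I -> \bar R) : (forall t, 0 <= a t) ->
  \esum_(t in [set: I]) a t = \sum_(0 <= n <oo) oapp a 0 (pickle_inv n).
Proof.
move=> a0; rewrite nneseries_esumT; last by move=> n; case: pickle_inv => /=.
have -> : \esum_(t in [set: I]) a t =
    \esum_(t in [set: I]) oapp a 0 (pickle_inv (pickle t)).
  by apply: eq_esum => t _; rewrite pickleK_inv.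
rewrite -(esum_image [set: I] pickle (fun n => oapp a 0 (pickle_inv n))).
  rewrite esum_mkcond; apply: eq_esum => n _; case: ifPn => //.
  case nt: (pickle_inv n) => [t|//] /negP[]; rewrite inE; exists t => //.
  by have := @pickle_invK I n; rewrite nt.
by move=> s t _ _ /(congr1 (@pickle_inv I)); rewrite !pickleK_inv => -[].
Qed.

Lemma measurable_bigcup_countable (D : set I) (A : I -> set T) :
  (forall t, D t -> measurable (A t)) -> measurable (\bigcup_(t in D) A t).
Proof.
move=> mA; rewrite bigcup_mkcond; apply: countable_bigcupT_measurable => // t.
by case: ifPn => //; rewrite inE; exact: mA.
Qed.

Lemma measurable_bigcap_countable (D : set I) (A : I -> set T) :
  (forall t, D t -> measurable (A t)) -> measurable (\bigcap_(t in D) A t).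
Proof.
move=> mA; rewrite -[X in measurable X]setCK setC_bigcap; apply: measurableC.
by apply: measurable_bigcup_countable => t /mA; exact: measurableC.
Qed.

Lemma measurable_ereal_sup (f : I -> T -> \bar R) :
  (forall t, measurable_fun setT (f t)) ->
  measurable_fun setT (fun x => ereal_sup [set f t x | t in [set: I]]).
Proof.
move=> mf; apply: (measurability _ (ErealGenOInfty.measurableE R)).
move=> /= _ [_ [x ->]] <-; rewrite setTI.
rewrite (_ : _ @^-1` _ = \bigcup_t (f t @^-1` `]x%:E, +oo[)).
  apply: measurable_bigcup_countable => t _; rewrite -[X in measurable X]setTI.
  by apply: mf => //; exact: emeasurable_itv.
apply/seteqP; split => y /=; rewrite in_itv/= andbT.
  by move=> /ereal_sup_gt[_ [t _ <-]] xt; exists t => //=; rewrite in_itv/= xt.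
move=> [t _] /=; rewrite in_itv/= andbT => /lt_le_trans; apply.
by apply: ereal_sup_ubound; exists t.
Qed.

Lemma ae_forall_countable (mu : {measure set T -> \bar R})
    (Q : I -> T -> Prop) :
  (forall i, {ae mu, forall x, Q i x}) -> {ae mu, forall x i, Q i x}.
Proof.
move=> aeQ; pose Qn n x := if pickle_inv n is Some i then Q i x else True.
have /ae_foralln : forall n, {ae mu, forall x, Qn n x}.
  by move=> n; rewrite /Qn; case: pickle_inv => [i|]; [exact: aeQ|exact: aeW].
by apply: filterS => x Qx i; have := Qx (pickle i); rewrite /Qn pickleK_inv.
Qed.

End CountableIndex.

Section CountableSum.
Import finmap.
Context {R : realType} {I : countType} {d : measure_display}.
Context {T : measurableType d}.
Local Open Scope ereal_scope.

Lemma measurable_esum (f : I -> T -> \bar R) :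
  (forall t, measurable_fun setT (f t)) ->
  measurable_fun setT (fun x => \esum_(t in [set: I]) f t x).
Proof.
move=> mf; under eq_fun do rewrite esum_ereal_sup_fset.
apply: (@measurable_ereal_sup R {fset I} _ T
  (fun B x => \sum_(t <- B) f t x)) => B.
exact: emeasurable_sum.
Qed.

Lemma integral_esum (mu : {measure set T -> \bar R}) (f : I -> T -> \bar R) :
  (forall t, measurable_fun setT (f t)) -> (forall t x, 0 <= f t x) ->
  \int[mu]_x (\esum_(t in [set: I]) f t x) =
  \esum_(t in [set: I]) \int[mu]_x f t x.
Proof.
move=> mf f0; under eq_integral do rewrite esum_pickle//.
rewrite integral_nneseries//; last 2 first.
- by move=> n; case: pickle_inv => //= t; exact: mf.
- by move=> n x _; case: pickle_inv => /=.
rewrite esum_pickle; last by move=> t; exact: integral_ge0.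
apply: eq_eseriesr => n _; case: pickle_inv => //=.
by rewrite integral0.
Qed.

End CountableSum.

Section ESum.
Context {R : realType} {I : choiceType}.
Implicit Types (D : set I) (a : I -> \bar R).
Local Open Scope ereal_scope.

(* The sum is the supremum of the finite subsums, so negative terms never
   contribute. *)
Lemma esum_maxe0 D a : \esum_(t in D) a t = \esum_(t in D) maxe (a t) 0.
Proof.
apply/le_anti/andP; split; first by apply: le_esum => t _; rewrite le_max lexx.
apply: ge_ereal_sup => _ [A [finA AD] <-]; pose A' := A `&` [set t | 0 < a t].
apply: esum_ge; exists A'; first by split; [exact: finite_setIl|move=> t [/AD]].
rewrite (fsbigID [set t | 0 < a t])//= [X in _ + X]fsbig1 ?adde0.
  rewrite le_eqVlt; apply/orP; left; apply/eqP; apply: eq_fsbigr => t.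
  by rewrite inE => -[_ /= /ltW at0]; rewrite max_l.
by move=> t [_ /= /negP]; rewrite -leNgt => at0; rewrite max_r.
Qed.

Lemma esum_max_term D a t : D t -> a t <= \esum_(s in D) a s.
Proof.
move=> Dt; apply: esum_ge; exists [set t]; last by rewrite fsbig_set1.
by split => [|s -> //]; exact: finite_set1.
Qed.

Lemma ge0_esumZl D (c : R) a : (0 <= c)%R -> (forall t, D t -> 0 <= a t) ->
  \esum_(t in D) (c%:E * a t) = c%:E * \esum_(t in D) a t.
Proof.
rewrite le_eqVlt => /predU1P[<- _|c0 a0].
  by rewrite mul0e esum1// => t _; rewrite mul0e.
rewrite /esum -ereal_sup_pZl// image_comp; congr ereal_sup.
apply/eq_imagel => A [finA AD] /=; rewrite !fsbig_finite//=.
rewrite big_seq [X in _ = _ * X]big_seq ge0_sume_distrr// => t.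
by rewrite in_fset_set// inE => /AD/a0.
Qed.

Lemma esum_only1 D a j : D j -> 0 <= a j ->
  (forall t, D t -> t != j -> a t = 0) -> \esum_(t in D) a t = a j.
Proof.
move=> Dj aj a0; rewrite -[RHS](esum_set1 (t := j))//.
rewrite [RHS]esum_mkcond esum_mkcond.
apply: eq_esum => t _; have [->|tj] := eqVneq t j; first by rewrite !mem_set.
rewrite [in RHS]memNset; last by move=> /= tE; rewrite tE eqxx in tj.
by case: ifPn => //; rewrite inE => Dt; exact: a0.
Qed.

End ESum.

Lemma finite_set_least {T : choiceType} (r : rel T) (A : set T) :
  transitive r -> total r -> finite_set A -> A !=set0 ->
  exists2 j, A j & forall k, A k -> r j k.
Proof.
move=> rtr rtot /finite_seqP[s ->] {A} [x /= xs].
have := sort_sorted rtot s; have smem := mem_sort r s.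
case: (sort r s) smem => [/(_ x)|j p smem]; first by rewrite xs.
move=> /(order_path_min rtr)/allP jp; exists j => [|k] /=.
  by rewrite -smem mem_head.
by rewrite -smem in_cons => /predU1P[->|/jp//]; have := rtot j j; rewrite orbb.
Qed.

(** * Measures and probabilities *)

Lemma measurable_preimageT {d1 d2 : measure_display} {T1 : measurableType d1}
    {T2 : measurableType d2} (F : T1 -> T2) (A : set T2) :
  measurable_fun setT F -> measurable A -> measurable (F @^-1` A).
Proof. by move=> mF mA; rewrite -[X in measurable X]setTI; exact: mF. Qed.

Lemma measurable_ltr_set {d : measure_display} {T : measurableType d}
    {R : realType} (f g : T -> R) :
  measurable_fun setT f -> measurable_fun setT g ->
  measurable [set x | f x < g x].
Proof.
move=> mf mg; exact: measurable_preimageT (measurable_fun_ltr mf mg) _.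
Qed.

Lemma eq_indic {R : pzRingType} {T1 T2 : Type} (A : set T1) (B : set T2) x y :
  (A x <-> B y) -> \1_A x = \1_B y :> R.
Proof.
by move=> AB; rewrite !indicE; congr (nat_of_bool _)%:R; apply/asbool_equiv_eq.
Qed.

Lemma invr_measurable {R : realType} : measurable_fun [set: R] (@GRing.inv R).
Proof.
rewrite (_ : @GRing.inv R = fun x => x * (x ^+ 2) `^ (-1)); last first.
  apply/funext => x; rewrite powR_inv1 ?sqr_ge0//.
  have [->|x0] := eqVneq x 0; first by rewrite invr0 mul0r.
  by rewrite expr2 invfM mulrA divff// mul1r.
apply: measurable_funM => //.
apply: (measurableT_comp (@measurable_powR R (-1))).
exact: exprn_measurable.
Qed.

Section AlmostEverywhere.
Context {d : measure_display} {T : measurableType d} {R : realType}.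
Implicit Types (mu : {measure set T -> \bar R}) (P : probability T R).
Implicit Types A B : set T.

Lemma integral_indicT mu A : measurable A ->
  (\int[mu]_x (\1_A x)%:E = mu A)%E.
Proof. by move=> mA; rewrite integral_indic// setIT. Qed.

Lemma ae_eq_measure mu A B : measurable A -> measurable B ->
  {ae mu, forall x, A x <-> B x} -> mu A = mu B.
Proof.
move=> mA mB AB; rewrite -!integral_indicT//; apply: ge0_ae_eq_integral => //.
- exact/measurable_EFinP/measurable_indic.
- exact/measurable_EFinP/measurable_indic.
- by apply: filterS AB => x ABx _; congr EFin; exact: eq_indic.
Qed.

Lemma measure0_ae_not mu A : measurable A -> mu A = 0%E ->
  {ae mu, forall x, ~ A x}.
Proof. by move=> mA A0; exists A; split => // x /contrapT. Qed.

Lemma ae_not_measure0 mu A : measurable A -> {ae mu, forall x, ~ A x} ->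
  mu A = 0%E.
Proof.
move=> mA nA; rewrite -(measure0 mu); apply: ae_eq_measure => //.
exact: filterS nA.
Qed.

Lemma probability1_ae P A : measurable A -> P A = 1%E -> {ae P, forall x, A x}.
Proof.
move=> mA A1; have PA : P (~` A) = 0%E by rewrite probability_setC// A1 subee.
by apply: filterS (measure0_ae_not (measurableC mA) PA) => x /contrapT.
Qed.

Lemma probabilityI_eq_ae P A B : measurable A -> measurable B ->
  P (A `&` B) = P B -> {ae P, forall x, B x -> A x}.
Proof.
move=> mA mB PAB; have PBA : P (B `\` A) = 0%E.
  rewrite measureD//; last exact: le_lt_trans (probability_le1 P mB) (ltry 1).
  transitivity (P B - P (A `&` B))%E; first by rewrite setIC.
  by rewrite PAB subee// fin_num_measure.
apply: filterS (measure0_ae_not (measurableD mB mA) PBA) => x BA Bx.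
by apply: contrapT => nAx; apply: BA.
Qed.

Lemma probability_fin_num P A : measurable A -> P A \is a fin_num.
Proof. exact: fin_num_measure. Qed.

Lemma integral_indic_lty mu A (g : T -> \bar R) : measurable A ->
  measurable_fun setT g -> (forall x, 0 <= g x)%E ->
  (\int[mu]_x ((\1_A x)%:E * g x) < +oo)%E ->
  {ae mu, forall x, A x -> (g x < +oo)%E}.
Proof.
move=> mA mg g0 intAg; pose Ag x := ((\1_A x)%:E * g x)%E.
have Ag0 x : (0 <= Ag x)%E by rewrite mule_ge0// lee_fin.
have /integrable_ae : mu.-integrable setT Ag.
  apply/integrableP; split.
    by apply: emeasurable_funM => //; exact/measurable_EFinP/measurable_indic.
  by under eq_integral do rewrite gee0_abs//.
move=> /(_ measurableT); apply: filterS => x /(_ Logic.I) + Ax.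
by rewrite /Ag indicE mem_set// mul1e => /fin_numPlt/andP[].
Qed.

End AlmostEverywhere.

Section WeightedIntegral.
Import HBNNSimple.
Context {R : realType} {d1 d2 : measure_display}.
Context {T : measurableType d1} {E : measurableType d2}.
Context (mu : {measure set T -> \bar R}) (z : T -> R) (F : T -> E).
Context (mz : measurable_fun setT z) (z0 : forall x, 0 <= z x).
Context (mF : measurable_fun setT F).
Local Open Scope ereal_scope.

Lemma integral_weighted_nnsfun (h : {nnsfun E >-> R}) :
  \int[mu]_x ((z x)%:E * (h (F x))%:E) =
  \sum_(y \in range h)
    y%:E * \int[mu]_x ((z x)%:E * (\1_(h @^-1` [set y]) (F x))%:E).
Proof.
have mzF y : measurable_fun setT
    (fun x => (z x)%:E * (\1_(h @^-1` [set y]) (F x))%:E).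
  apply: emeasurable_funM; apply/measurable_EFinP => //.
  exact: measurableT_comp.
under eq_integral => x _.
  rewrite fimfunE -fsumEFin// ge0_mule_fsumr; last first.
    by move=> y; rewrite EFinM nnfun_muleindic_ge0.
  over.
rewrite ge0_integral_fsum//; last 2 first.
- by move=> y; under eq_fun do rewrite EFinM muleCA; exact: emeasurable_funM.
- by move=> y x _; rewrite EFinM mule_ge0 ?nnfun_muleindic_ge0// lee_fin.
apply: eq_fsbigr => y; rewrite inE => -[x _ <-].
under eq_integral do rewrite EFinM muleCA.
by rewrite ge0_integralZl_EFin// => w _; rewrite mule_ge0// lee_fin.
Qed.

Lemma cvg_integral_weighted (G : E -> \bar R) (mG : measurable_fun setT G) :
  (forall y, 0 <= G y) ->
  \int[mu]_x ((z x)%:E * (nnsfun_approx measurableT mG n (F x))%:E)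
    @[n --> \oo] --> \int[mu]_x ((z x)%:E * G (F x)).
Proof.
move=> G0; pose h n : E -> R := nnsfun_approx measurableT mG n.
have hG y : (h n y)%:E @[n --> \oo] --> G y.
  exact: (cvg_nnsfun_approx measurableT mG (fun y _ => G0 y) (x := y)).
rewrite (eq_integral (fun x => limn (fun n => (z x)%:E * (h n (F x))%:E))).
  apply: cvg_monotone_convergence => //.
  - move=> n; apply: emeasurable_funM; apply/measurable_EFinP => //.
    exact: measurableT_comp.
  - by move=> n x _; rewrite lee_fin mulr_ge0.
  - move=> x _ n m nm; rewrite lee_fin ler_wpM2l//.
    by have /asboolP/(_ (F x)) := nd_nnsfun_approx measurableT mG nm.
by move=> x _; apply/esym/cvg_lim => //; apply: cvgeZl => //; exact: hG.
Qed.

End WeightedIntegral.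

Section EqIntegralWeighted.
Import HBNNSimple.
Context {R : realType} {d1 d2 d3 : measure_display}.
Context {T1 : measurableType d1} {T2 : measurableType d2}.
Context {E : measurableType d3}.
Context (m1 : {measure set T1 -> \bar R}) (m2 : {measure set T2 -> \bar R}).
Context (z1 : T1 -> R) (z2 : T2 -> R) (F1 : T1 -> E) (F2 : T2 -> E).
Context (mz1 : measurable_fun setT z1) (z10 : forall x, 0 <= z1 x).
Context (mz2 : measurable_fun setT z2) (z20 : forall x, 0 <= z2 x).
Context (mF1 : measurable_fun setT F1) (mF2 : measurable_fun setT F2).
Local Open Scope ereal_scope.

Lemma eq_integral_weighted (G : E -> \bar R) :
  (forall A : set E, measurable A ->
    \int[m1]_x ((z1 x)%:E * (\1_A (F1 x))%:E) =
    \int[m2]_x ((z2 x)%:E * (\1_A (F2 x))%:E)) ->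
  measurable_fun setT G -> (forall y, 0 <= G y) ->
  \int[m1]_x ((z1 x)%:E * G (F1 x)) = \int[m2]_x ((z2 x)%:E * G (F2 x)).
Proof.
move=> eqA mG G0.
have eq_nnsfun (h : {nnsfun E >-> R}) :
    \int[m1]_x ((z1 x)%:E * (h (F1 x))%:E) =
    \int[m2]_x ((z2 x)%:E * (h (F2 x))%:E).
  rewrite !integral_weighted_nnsfun//.
  by apply: eq_fsbigr => y _; rewrite eqA.
have := cvg_integral_weighted (mu := m1) mz1 z10 mF1 mG G0.
under eq_fun do rewrite eq_nnsfun.
move=> /cvg_lim <-//; apply: cvg_lim => //.
exact: cvg_integral_weighted.
Qed.

End EqIntegralWeighted.

Section Independence.
Context {R : realType} {d d1 d2 : measure_display}.
Context {T : measurableType d}.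
Context {T1 : measurableType d1} {T2 : measurableType d2}.
Context (P : probability T R).

Definition independent (X1 : T -> T1) (X2 : T -> T2) :=
  forall (A : set T1) (B : set T2), measurable A -> measurable B ->
  P [set w | A (X1 w) /\ B (X2 w)] =
  (P [set w | A (X1 w)] * P [set w | B (X2 w)])%E.

Context (X1 : T -> T1) (X2 : T -> T2).
Context (mX1 : measurable_fun setT X1) (mX2 : measurable_fun setT X2).

Lemma integral_independent (F : T1 * T2 -> \bar R) : independent X1 X2 ->
  measurable_fun setT F -> (forall z, (0 <= F z)%E) ->
  (\int[P]_w F (X1 w, X2 w) = \int[P]_w \int[P]_v F (X1 v, X2 w))%E.
Proof.
move=> indep mF F0.
pose V1 : {mfun T >-> T1} := mfun_Sub (mem_set mX1).
pose V2 : {mfun T >-> T2} := mfun_Sub (mem_set mX2).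
pose V : {mfun T >-> (T1 * T2)%type} :=
  mfun_Sub (mem_set (measurable_fun_pair mX1 mX2)).
transitivity (\int[distribution P V]_z F z)%E.
  by rewrite ge0_integral_distribution.
transitivity (\int[distribution P V1 \x distribution P V2]_z F z)%E.
  apply: eq_measure_integral => A mA _; apply/esym.
  by apply: product_measure_unique => // B C mB mC; exact: indep.
rewrite fubini_tonelli2// ge0_integral_distribution.
- apply: eq_integral => w _.
  have mFw := measurableT_comp mF (pair2_measurable (X2 w)).
  exact: (ge0_integral_distribution V1 mFw (fun=> F0 _)).
- exact: measurable_fun_fubini_tonelli_G.
- by move=> y; exact: integral_ge0.
Qed.

Lemma probability_independent (A : set (T1 * T2)) : independent X1 X2 ->
  measurable A ->
  P [set w | A (X1 w, X2 w)] = (\int[P]_w P [set v | A (X1 v, X2 w)])%E.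
Proof.
move=> indep mA.
have mX : measurable_fun setT (fun w => (X1 w, X2 w)).
  exact: measurable_fun_pair.
have mXw w : measurable_fun setT (fun v => (X1 v, X2 w)).
  exact: measurable_fun_pair.
rewrite -integral_indicT; last exact: measurable_preimageT mX mA.
rewrite (integral_independent (F := EFin \o \1_A))//.
- apply: eq_integral => w _; rewrite -integral_indicT//.
  exact: measurable_preimageT (mXw w) mA.
- exact/measurable_EFinP/measurable_indic.
- by move=> z; rewrite lee_fin.
Qed.

End Independence.

(** * Configurations on the lattice *)

Notation fieldspace R d := (g_sigma_algebraType (@cylinders R d)).

Section FieldSpace.
Context {R : realType} {d : nat}.
Local Notation E := (fieldspace R d).

Lemma measurable_coord (t : Zd d) :
  measurable_fun setT (fun f : E => (f t : R)).
Proof.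
by move=> _ B mB; rewrite setTI; apply: sub_sigma_algebra; exists t, B.
Qed.

Lemma measurable_field {dT : measure_display} {T : measurableType dT}
    (F : T -> E) :
  (forall t, measurable_fun setT (fun w => F w t : R)) -> measurable_fun setT F.
Proof.
move=> mF; apply: (@measurability _ _ T E setT F (@cylinders R d)) => //.
by move=> /= _ [_ [t [B [mB ->]]]] <-; exact: mF.
Qed.

Lemma measurable_Bshift (h : Zd d) : measurable_fun setT (Bshift h : E -> E).
Proof. by apply: measurable_field => t; exact: measurable_coord. Qed.

Lemma measurable_coord_gt (t : Zd d) (c : R) :
  measurable [set f : E | c < (f t : R)].
Proof. by apply: measurable_ltr_set => //; exact: measurable_coord. Qed.

Definition exceeds (t : Zd d) : set E := [set f | 1 < (f t : R)].

Lemma measurable_exceeds t : measurable (exceeds t).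
Proof. exact: measurable_coord_gt. Qed.

Lemma measurable_coord_lt (s t : Zd d) :
  measurable [set f : E | (f s : R) < f t].
Proof. by apply: measurable_ltr_set; exact: measurable_coord. Qed.

Lemma measurable_coord_le (t : Zd d) (c : R) :
  measurable [set f : E | (f t : R) <= c].
Proof.
rewrite (_ : [set _ | _] = ~` [set f : E | c < (f t : R)]).
  by apply: measurableC; exact: measurable_coord_gt.
by apply/seteqP; split => f /=; rewrite leNgt => /negP.
Qed.

Lemma measurable_coord_eq (t : Zd d) (c : R) :
  measurable [set f : E | (f t : R) = c].
Proof.
exact: measurable_preimageT (measurable_coord t) (measurable_set1 c).
Qed.

Lemma measurable_inE : measurable [set f : E | Defs.inE f].
Proof.
rewrite (_ : [set _ | _] = \bigcap_t ~` [set f : E | (f t : R) < 0]).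
  apply: measurable_bigcap_countable => t _; apply: measurableC.
  by apply: measurable_ltr_set => //; exact: measurable_coord.
apply/seteqP; split => [f f0 t _ /=|f f0 t].
- by apply/negP; rewrite -leNgt.
- by have /negP := f0 t I; rewrite -leNgt.
Qed.

Lemma measurable_supf : measurable_fun setT (@supf R d : E -> \bar R).
Proof.
apply: (@measurable_ereal_sup R (Zd d) _ E (fun t f => (f t)%:E)) => t.
by apply/measurable_EFinP; exact: measurable_coord.
Qed.

Lemma measurable_SS : measurable_fun setT (@SS R d : E -> \bar R).
Proof.
apply: (@measurable_esum R (Zd d) _ E (fun t f => (f t)%:E)) => t.
by apply/measurable_EFinP; exact: measurable_coord.
Qed.

Lemma measurable_SS_lty : measurable [set f : E | (SS f < +oo)%E].
Proof.
by have := emeasurable_fun_infty_o measurableT measurable_SS +oo%E;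
  rewrite setTI.
Qed.

Lemma BBE (f : E) : BB f = \esum_(t in [set: Zd d]) (\1_(exceeds t) f)%:E.
Proof.
apply: eq_esum => t _; rewrite indicE; case: ifPn => ft.
- by rewrite mem_set.
- by rewrite memNset//; exact/negP.
Qed.

Lemma measurable_BB : measurable_fun setT (@BB R d : E -> \bar R).
Proof.
rewrite (_ : BB = fun f : E => \esum_(t in [set: Zd d]) (\1_(exceeds t) f)%:E).
  apply: (@measurable_esum R (Zd d) _ E) => t.
  by apply/measurable_EFinP/measurable_indic; exact: measurable_exceeds.
by apply/funext => f; exact: BBE.
Qed.

End FieldSpace.

Section Functionals.
Context {R : realType} {d : nat}.
Implicit Types (f : Zd d -> R) (c : R) (h t : Zd d).

Lemma BshiftD h1 h2 f : Bshift h1 (Bshift h2 f) = Bshift (h1 + h2) f.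
Proof. by apply/funext => t; rewrite /Bshift opprD addrA. Qed.

Lemma Bshift0 f : Bshift 0 f = f.
Proof. by apply/funext => t; rewrite /Bshift subr0. Qed.

Lemma BshiftN h t f : Bshift (- h) f t = f (t + h).
Proof. by rewrite /Bshift opprK. Qed.

Lemma inE_Bshift h f : Defs.inE f -> Defs.inE (Bshift h f).
Proof. by move=> f0 t; exact: f0. Qed.

Lemma inE_scale c f : Defs.inE f -> 0 <= c -> Defs.inE (fun t => c * f t).
Proof. by move=> f0 c0 t; rewrite mulr_ge0. Qed.

Lemma esum_translate (a : Zd d -> \bar R) h :
  \esum_(t in [set: Zd d]) a (t - h) = \esum_(t in [set: Zd d]) a t.
Proof.
rewrite [RHS](reindex_esum [set: Zd d] _ (fun t => t - h))//.
split=> //; first by move=> s t _ _ /addIr.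
by move=> t _; exists (t + h); rewrite ?addrK.
Qed.

Lemma esum_opp (a : Zd d -> \bar R) :
  \esum_(t in [set: Zd d]) a (- t) = \esum_(t in [set: Zd d]) a t.
Proof. by rewrite [RHS](reindex_esum [set: Zd d] _ (fun t => - t)). Qed.

Lemma SS_Bshift h f : SS (Bshift h f) = SS f.
Proof. exact: (esum_translate (fun t => (f t)%:E)). Qed.

Lemma BB_Bshift h f : BB (Bshift h f) = BB f.
Proof.
exact: (esum_translate (fun t => (if 1 < f t then 1 else 0 : R)%:E)).
Qed.

Lemma supf_Bshift h f : supf (Bshift h f) = supf f.
Proof.
congr ereal_sup; apply/seteqP; split => [_ [t _ <-]|_ [t _ <-]].
  by exists (t - h).
by exists (t + h); rewrite // /Bshift addrK.
Qed.

Lemma SS_ge0 f : (0 <= SS f)%E.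
Proof.
by rewrite /SS esum_maxe0 esum_ge0// => t _; rewrite le_max lexx orbT.
Qed.

Lemma BB_ge0 f : (0 <= BB f)%E.
Proof. by apply: esum_ge0 => t _; rewrite lee_fin; case: ifP. Qed.

Lemma supf_ge f t : ((f t)%:E <= supf f)%E.
Proof. by apply: ereal_sup_ubound; exists t. Qed.

Lemma SS_ge f t : ((f t)%:E <= SS f)%E.
Proof. exact: (@esum_max_term _ _ _ (fun t => (f t)%:E)). Qed.

Lemma supf_le_SS f : (supf f <= SS f)%E.
Proof. by apply: ge_ereal_sup => _ [t _ <-]; exact: SS_ge. Qed.

Lemma BB_ge1 f t : 1 < f t -> (1 <= BB f)%E.
Proof.
move=> ft; have <- : (\1_(exceeds t) f)%:E = 1%E :> \bar R.
  by rewrite indicE mem_set.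
by rewrite BBE; exact: (@esum_max_term R _ _ (fun s => (\1_(exceeds s) f)%:E)).
Qed.

Lemma BB_le_SS f : (BB f <= SS f)%E.
Proof.
rewrite /SS esum_maxe0; apply: le_esum => t _; case: ifPn => [/ltW ft|_].
  by rewrite le_max lee_fin ft.
by rewrite le_max lexx orbT.
Qed.

Lemma SS_scale f c : Defs.inE f -> 0 <= c ->
  SS (fun t => c * f t) = (c%:E * SS f)%E.
Proof.
move=> f0 c0; rewrite /SS -ge0_esumZl// => t _.
by rewrite lee_fin.
Qed.

Lemma supf_scale f c : 0 < c -> supf (fun t => c * f t) = (c%:E * supf f)%E.
Proof.
by move=> c0; rewrite /supf -ereal_sup_pZl//; congr ereal_sup;
  rewrite image_comp.
Qed.

Lemma SS_scale_lty f c : Defs.inE f -> 0 < c ->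
  (SS (fun t => (c * f t)%R) < +oo)%E <-> (SS f < +oo)%E.
Proof.
move=> f0 c0; rewrite SS_scale// ?ltW//.
have := SS_ge0 f; case: (SS f) => [r| |]//= _; first by rewrite -EFinM !ltry.
by rewrite gt0_muley ?lte_fin.
Qed.

Import finmap.

Lemma BB_lty_finite f : (BB f < +oo)%E -> finite_set [set t | 1 < f t].
Proof.
have := BB_ge0 f; case BBf : (BB f) => [b| |]// b0 _.
apply: contrapT => /infinite_set_fsetP /(_ (Num.truncn b).+1)[B B1 sizeB].
suff : ((size (enum_fset B))%:R%:E <= BB f)%E.
  rewrite BBf lee_fin; apply/negP; rewrite -ltNge.
  by apply: lt_le_trans (truncnS_gt b) _; rewrite ler_nat.
apply: esum_ge; exists [set` B] => //.
rewrite fsbig_finite//= set_fsetK (eq_big_seq (fun=> 1%:E)) => [|t tB].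
  by rewrite sumEFin big_const_seq count_predT iter_addr_0.
by rewrite (B1 t tB : 1 < f t).
Qed.

Lemma SS_lty_finite f c : Defs.inE f -> 0 < c -> (SS f < +oo)%E ->
  finite_set [set t | c < f t].
Proof.
move=> f0 c0 Sf; rewrite (_ : [set _ | _] = [set t | 1 < c^-1 * f t]).
  apply: BB_lty_finite; apply: le_lt_trans (BB_le_SS _) _.
  by apply/SS_scale_lty => //; rewrite invr_gt0.
by apply/seteqP; split => t /=; rewrite ltr_pdivlMl// mulr1.
Qed.

End Functionals.

Section Ratios.
Context {R : realType} {d : nat}.
Implicit Types (f : Zd d -> R) (c : R).

(* [fine +oo = 0] and [0^-1 = 0], so both conventions of [ediv] are those of
   division in [R]. *)
Definition inv_BB f : R := (fine (BB f))^-1.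

Lemma ediv1_BB f : ediv 1 (BB f) = (inv_BB f)%:E.
Proof.
rewrite /inv_BB; case: (BB f) => [b| |] /=; rewrite ?invr0//.
by case: ifPn => [/eqP->|_]; rewrite ?invr0 ?mul1e.
Qed.

Lemma inv_BB_ge0 f : 0 <= inv_BB f.
Proof. by rewrite invr_ge0 fine_ge0// BB_ge0. Qed.

Lemma inv_BB_Bshift h f : inv_BB (Bshift h f) = inv_BB f.
Proof. by rewrite /inv_BB BB_Bshift. Qed.

Lemma inv_BB_infty f : BB f = +oo%E -> inv_BB f = 0.
Proof. by rewrite /inv_BB => ->; rewrite invr0. Qed.

Lemma inv_BB_mul f t : 1 < f t -> (BB f < +oo)%E ->
  ((inv_BB f)%:E * BB f = 1)%E.
Proof.
move=> /BB_ge1; rewrite /inv_BB; case: (BB f) => // b; rewrite lee_fin => b1 _.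
by rewrite -EFinM mulVf// gt_eqF// (lt_le_trans ltr01).
Qed.

Lemma measurable_inv_BB : measurable_fun setT (@inv_BB : fieldspace R d -> R).
Proof.
apply: measurableT_comp invr_measurable _.
exact: measurableT_comp (fine_measurable measurableT) measurable_BB.
Qed.

Definition sup_over_sum f : R := fine (supf f) / fine (SS f).

Lemma ediv_supf_SS f : ediv (supf f) (SS f) = (sup_over_sum f)%:E.
Proof.
rewrite /sup_over_sum; have := supf_ge f 0; have := supf_le_SS f.
case: (SS f) => [r| |] /=; rewrite ?invr0 ?mulr0//.
case: (supf f) => [s| |]// _ _; case: ifPn => [/eqP->|_]; last by rewrite EFinM.
by rewrite invr0 mulr0.
Qed.

Lemma sup_over_sum_ge0 f : 0 <= sup_over_sum f.
Proof.
have [s0|s0] := leP 0%E (supf f); first by rewrite divr_ge0 ?fine_ge0 ?SS_ge0.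
rewrite /sup_over_sum /SS esum_maxe0 esum1 ?invr0 ?mulr0// => t _.
by rewrite max_r// ltW// (le_lt_trans (supf_ge f t)).
Qed.

Lemma sup_over_sum_Bshift h f : sup_over_sum (Bshift h f) = sup_over_sum f.
Proof. by rewrite /sup_over_sum supf_Bshift SS_Bshift. Qed.

Lemma sup_over_sum_scale f c : Defs.inE f -> 0 < c ->
  sup_over_sum (fun t => c * f t) = sup_over_sum f.
Proof.
move=> f0 c0; rewrite /sup_over_sum supf_scale// SS_scale ?ltW//.
have c_neq0 : c != 0 by rewrite gt_eqF.
have := SS_ge0 f; have := supf_le_SS f; have := supf_ge f 0.
case: (SS f) => [r| |]//; last by rewrite gt0_muley ?lte_fin//= invr0 !mulr0.
by case: (supf f) => [s| |]//= _ _ _; rewrite invfM mulrACA divff// mul1r.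
Qed.

Lemma sup_over_sum_SS_infty f : SS f = +oo%E -> sup_over_sum f = 0.
Proof. by rewrite /sup_over_sum => ->; rewrite invr0 mulr0. Qed.

Lemma measurable_sup_over_sum :
  measurable_fun setT (@sup_over_sum : fieldspace R d -> R).
Proof.
apply: measurable_funM.
  exact: measurableT_comp (fine_measurable measurableT) measurable_supf.
apply: measurableT_comp invr_measurable _.
exact: measurableT_comp (fine_measurable measurableT) measurable_SS.
Qed.

End Ratios.

(** * Selectors *)

Section Selectors.
Context {R : realType} {d : nat}.
Implicit Types f : Zd d -> R.

(* [Q (Bshift (- j) f)] reads: the point [j] of [f] is selected by [Q]. *)
Definition selector (Q : set (Zd d -> R)) :=
  forall f j k, Q (Bshift (- j) f) -> Q (Bshift (- k) f) -> j = k.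

Definition seen_from_exceedance (Q : set (Zd d -> R)) : set (Zd d -> R) :=
  [set f | exists2 j, Q (Bshift (- j) f) & 1 < f j].

Lemma sub_selector (Q Q' : set (Zd d -> R)) :
  Q' `<=` Q -> selector Q -> selector Q'.
Proof. by move=> sub sQ f j k /sub Qj /sub Qk; exact: sQ Qj Qk. Qed.

Lemma measurable_seen_from_exceedance (Q : set (fieldspace R d)) :
  measurable Q ->
  measurable (seen_from_exceedance Q : set (fieldspace R d)).
Proof.
move=> mQ; rewrite (_ : seen_from_exceedance Q = \bigcup_j
    ((Bshift (- j) : fieldspace R d -> fieldspace R d) @^-1` Q `&` exceeds j)).
  apply: measurable_bigcup_countable => j _; apply: measurableI.
    exact: measurable_preimageT (measurable_Bshift _) mQ.
  exact: measurable_exceeds.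
by apply/seteqP; split => [f [j Qj fj]|f [j _ [Qj fj]]]; exists j.
Qed.

Section Anchoring.
Context (I : (Zd d -> R) -> option (Zd d)) (anchI : anchoring I).

Definition anchored_at0 : set (Zd d -> R) :=
  [set f | I f = Some 0 /\ Defs.inE f].

Lemma anchoring_Bshift f j k : Defs.inE f -> I f = Some j ->
  I (Bshift k f) = Some (j + k).
Proof.
move=> f0 Ij; have [_ /(_ f f0)] := anchI; rewrite Ij => -[]// _ /(_ k).
by case: (I (Bshift k f)) => //= l [->]; rewrite subrK.
Qed.

Lemma selector_anchored_at0 : selector anchored_at0.
Proof.
move=> f j k [Ij f0] [Ik _]; have := anchoring_Bshift (j - k) f0 Ij.
rewrite BshiftD addrAC subrr !add0r Ik => -[/esym/eqP].
by rewrite subr_eq0 => /eqP.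
Qed.

Lemma anchoring_seen_from_exceedance f j : Defs.inE f -> 1 < f 0 -> f j <> 1 ->
  I f = Some j -> seen_from_exceedance anchored_at0 f.
Proof.
move=> f0 f1 fj Ij; exists j; last first.
  have [_ /(_ f f0)] := anchI; rewrite Ij => -[]// /(_ j erefl) + _.
  by rewrite (min_r (ltW f1)) le_eqVlt => /predU1P[/esym|].
split; last exact: inE_Bshift.
by rewrite (anchoring_Bshift (- j) f0 Ij) subrr.
Qed.

Lemma measurable_anchoring_eq (v : option (Zd d)) :
  measurable [set f : fieldspace R d | I f = v].
Proof. by case: anchI => /(_ v). Qed.

Lemma measurable_anchored_at0 :
  measurable (anchored_at0 : set (fieldspace R d)).
Proof. exact: measurableI (measurable_anchoring_eq _) measurable_inE. Qed.

End Anchoring.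

End Selectors.

(** * First exceedance and first maximum *)

Section FirstPoints.
Context {R : realType} {d : nat} (ord : rel (Zd d)) (ordP : ti_total_order ord).
Implicit Types f : Zd d -> R.
Local Notation E := (fieldspace R d).

Definition first_exceedance f := 1 < f 0 /\ forall k, 1 < f k -> ord 0 k.

Definition first_max f := forall k, f k <= f 0 /\ (f k = f 0 -> ord 0 k).

Lemma ord0B j k : ord 0 (k - j) = ord j k.
Proof. by case: ordP => _ _ _ _ /(_ 0 (k - j) j) ->; rewrite add0r subrK. Qed.

Lemma ord_anti j k : ord j k -> ord k j -> j = k.
Proof. by case: ordP => _ anti _ _ _ jk kj; apply: anti; rewrite jk. Qed.

Lemma first_exceedance_Bshift j f : first_exceedance (Bshift (- j) f) <->
  1 < f j /\ forall k, 1 < f k -> ord j k.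
Proof.
rewrite /first_exceedance BshiftN add0r; split => -[fj fmin]; split => // k.
  by move=> fk; rewrite -ord0B; apply: fmin; rewrite BshiftN subrK.
by rewrite BshiftN => /fmin; rewrite -ord0B addrK.
Qed.

Lemma first_max_Bshift j f : first_max (Bshift (- j) f) <->
  forall k, f k <= f j /\ (f k = f j -> ord j k).
Proof.
split => fm k; first by have := fm (k - j); rewrite !BshiftN subrK add0r ord0B.
by rewrite !BshiftN add0r; have := fm (k + j); rewrite -ord0B addrK.
Qed.

Lemma selector_first_exceedance : selector first_exceedance.
Proof.
move=> f j k /first_exceedance_Bshift[fj minj].
move=> /first_exceedance_Bshift[fk mink].
by apply: ord_anti; [exact: minj|exact: mink].
Qed.

Lemma selector_first_max : selector first_max.
Proof.
move=> f j k /first_max_Bshift maxj /first_max_Bshift maxk.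
have fjk : f j = f k by apply/le_anti; rewrite (maxj k).1 (maxk j).1.
by apply: ord_anti; [apply: (maxj k).2|apply: (maxk j).2].
Qed.

Lemma exists_first_exceedance f h : finite_set [set t | 1 < f t] -> 1 < f h ->
  exists2 j, first_exceedance (Bshift (- j) f) & 1 < f j.
Proof.
move=> fin fh; case: ordP => _ _ tr tot _.
have [j /= fj minj] := finite_set_least tr tot fin (ex_intro _ h fh).
by exists j => //; apply/first_exceedance_Bshift.
Qed.

Lemma exists_first_max f c h : finite_set [set t | c < f t] -> c < f h ->
  exists2 j, first_max (Bshift (- j) f) & c < f j.
Proof.
move=> fin fh; case: ordP => rf _ tr tot _.
pose r j k := (f k < f j) || ((f k == f j) && ord j k).
have rtr : transitive r.
  move=> j i k /orP[ij|/andP[/eqP ij oij]] /orP[jk|/andP[/eqP jk ojk]];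
    rewrite /r.
  - by rewrite (lt_trans jk ij).
  - by rewrite jk ij.
  - by rewrite -ij jk.
  - by rewrite jk ij eqxx (tr _ _ _ oij ojk) orbT.
have rtot : total r.
  by move=> j k; rewrite /r; case: ltgtP => //= _; rewrite ?orbT// tot.
have [j /= fj maxj] := finite_set_least rtr rtot fin (ex_intro _ h fh).
exists j => //; apply/first_max_Bshift => k.
have [/maxj/orP[kj|/andP[/eqP kj ojk]]|kc] := ltP c (f k).
- by split; [exact: ltW|move=> fkj; rewrite fkj ltxx in kj].
- by rewrite kj.
- have kj := le_lt_trans kc fj.
  by split; [exact: ltW|move=> fkj; rewrite fkj ltxx in kj].
Qed.

Lemma BB_lty_seen_first_exceedance f : (BB f < +oo)%E -> 1 < f 0 ->
  seen_from_exceedance first_exceedance f.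
Proof.
move=> /BB_lty_finite fin f1.
by have [j] := exists_first_exceedance fin f1; exists j.
Qed.

Lemma BB_lty_seen_first_max f : (BB f < +oo)%E -> 1 < f 0 ->
  seen_from_exceedance first_max f.
Proof.
move=> /BB_lty_finite fin f1.
by have [j] := exists_first_max fin f1; exists j.
Qed.

Lemma minset_eq (M : set (Zd d)) j : M j -> (forall k, M k -> ord j k) ->
  Defs.minset ord M = j.
Proof.
move=> Mj jM; apply: xget_unique; first by split.
by move=> k [Mk kM]; apply: ord_anti; [exact: kM|exact: jM].
Qed.

Lemma I_fe_eq0 f : I_fe ord f = Some 0 <-> first_exceedance f /\ (SS f < +oo)%E.
Proof.
rewrite /I_fe; case: pselect => [[Sf supf1]|undef]; last first.
  split=> // -[[f1 _] Sf]; exfalso; apply: undef; split=> //.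
  by apply: lt_le_trans (supf_ge f 0); rewrite lte_fin.
have /ereal_sup_gt[_ [h _ <-]] := supf1; rewrite lte_fin => fh.
have fin := BB_lty_finite (le_lt_trans (BB_le_SS f) Sf).
have [j /first_exceedance_Bshift[fj minj] _] := exists_first_exceedance fin fh.
rewrite (minset_eq (j := j))//; split => [[j0]|[[f1 min0] _]].
  by rewrite j0 in fj minj; split.
by congr Some; apply: ord_anti; [exact: minj|exact: min0].
Qed.

Lemma supf_first_max f : first_max f -> supf f = (f 0)%:E.
Proof.
move=> fm; apply/le_anti; rewrite supf_ge andbT;
  apply: ge_ereal_sup => _ [t _ <-].
by rewrite lee_fin; case: (fm t).
Qed.

Lemma sup_over_sum_first_max f : first_max f -> 0 < f 0 -> (SS f < +oo)%E ->
  ((sup_over_sum f)%:E * SS f = (f 0)%:E)%E.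
Proof.
move=> fm f0; rewrite /sup_over_sum (supf_first_max fm); have := SS_ge f 0.
case: (SS f) => // s; rewrite lee_fin => fs _.
by rewrite -EFinM divfK// gt_eqF// (lt_le_trans f0).
Qed.

Lemma first_max_scale f (c : R) : 0 < c ->
  first_max (fun t => c * f t) <-> first_max f.
Proof.
move=> c0; have c_inj : injective ( *%R c) by apply: mulfI; rewrite gt_eqF.
by split => fm k; have [le0 ordk] := fm k; split;
  [rewrite ler_pM2l in le0|move=> fk; apply: ordk; rewrite fk
  |rewrite ler_pM2l|move/c_inj].
Qed.

Lemma I_A_eq0 f : Defs.inE f ->
  I_A ord f = Some 0 <-> [/\ first_max f, 0 < f 0 & (SS f < +oo)%E].
Proof.
move=> f0; rewrite /I_A; case: pselect => [[Sf supf0]|undef]; last first.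
  split=> // -[fm fpos Sf]; exfalso; apply: undef; split=> //.
  by rewrite supf_first_max.
have /ereal_sup_gt[_ [h _ <-]] := supf0; rewrite lte_fin => fh.
have fh2 : 0 < f h / 2 by rewrite divr_gt0.
have [|j fm /(lt_trans fh2) fj] :=
  exists_first_max (SS_lty_finite f0 fh2 Sf) (h := h).
  by rewrite gtr_pMr// invf_lt1// ltr1n.
have sj : supf f = (f j)%:E.
  by rewrite -(supf_Bshift (- j)) supf_first_max// BshiftN add0r.
move/first_max_Bshift in fm.
rewrite (minset_eq (j := j))//; last first.
  by move=> k /=; rewrite sj => -[]; exact: (fm k).2.
split => [[j0]|[max0 _ _]]; first by rewrite j0 in fj fm; split.
congr Some; apply: (@selector_first_max f); first exact/first_max_Bshift.
by rewrite oppr0 Bshift0.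
Qed.

Lemma measurable_first_exceedance : measurable [set f : E | first_exceedance f].
Proof.
rewrite (_ : [set _ | _] = exceeds 0 `&`
    \bigcap_(k in [set k | ~~ ord 0 k]) [set f : E | f k <= 1]).
  apply: measurableI; first exact: measurable_exceeds.
  by apply: measurable_bigcap_countable => k _; exact: measurable_coord_le.
apply/seteqP; split => f /= [f1 min0]; split => // k /=.
  by move=> /negP k0; rewrite leNgt; apply/negP => /min0.
by move=> fk; apply: contraLR fk => k0; rewrite -leNgt; exact: min0.
Qed.

Lemma measurable_first_max : measurable [set f : E | first_max f].
Proof.
rewrite (_ : [set _ | _] = (\bigcap_k ~` [set f : E | f 0 < f k]) `&`
    \bigcap_(k in [set k | ~~ ord 0 k]) [set f : E | f k < f 0]).
  apply: measurableI; apply: measurable_bigcap_countable => k _.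
    by apply: measurableC; exact: measurable_coord_lt.
  exact: measurable_coord_lt.
apply/seteqP; split => f /=.
  move=> fm; split => k /=.
    by move=> _; apply/negP; rewrite -leNgt; case: (fm k).
  move=> k0; have [le0 e] := fm k; rewrite lt_neqAle le0 andbT.
  by apply: contra k0 => /eqP.
move=> [max0 before0] k; split; first by have /negP := max0 k I; rewrite -leNgt.
by move=> fk; apply: contrapT => /negP/before0 /=; rewrite fk ltxx.
Qed.

End FirstPoints.

Lemma ti_total_order_rev {d : nat} (ord : rel (Zd d)) :
  ti_total_order ord -> ti_total_order (fun x y => ord y x).
Proof.
case=> rf anti tr tot ti; split => //.
- by move=> x y /andP[yx xy]; apply: anti; rewrite xy.
- by move=> y x z yx zy; exact: tr zy yx.
Qed.

(** * Mass transport *)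

Section MassTransport.
Context {R : realType} {d : nat} {dT : measure_display} {T : measurableType dT}.
Local Notation E := (fieldspace R d).
Context (P : probability T R) (Y : T -> Zd d -> R).

Definition time_change := forall (h : Zd d) (A : set E), measurable A ->
  P (Y @^-1` (A `&` exceeds h)) =
    P ((Bshift h \o Y) @^-1` A `&` Y @^-1` exceeds (- h)).

Context (mY : measurable_fun setT (Y : T -> E)) (tc : time_change).

Lemma measurable_comp_Bshift h : measurable_fun setT (Bshift h \o Y : T -> E).
Proof. exact: measurableT_comp (@measurable_Bshift R d h) mY. Qed.

Lemma measurable_indic_exceeds t :
  measurable_fun setT (fun w => \1_(exceeds t) (Y w) : R).
Proof.
exact: measurableT_comp (measurable_indic (measurable_exceeds t)) mY.
Qed.

Lemma integral_time_change (h : Zd d) (G : E -> \bar R) :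
  measurable_fun setT G -> (forall f, (0 <= G f)%E) ->
  (\int[P]_w ((\1_(exceeds h) (Y w))%:E * G (Y w)) =
   \int[P]_w ((\1_(exceeds (- h)%R) (Y w))%:E * G (Bshift h (Y w))))%E.
Proof.
move=> mG G0.
apply: (eq_integral_weighted _ _ _ _ mY (measurable_comp_Bshift h)) => //.
- exact: measurable_indic_exceeds.
- exact: measurable_indic_exceeds.
move=> A mA; have indicM (B C : set T) w :
    ((\1_B w)%:E * (\1_C w)%:E = (\1_(C `&` B) w : R)%:E)%E.
  by rewrite setIC indicI EFinM.
have mYt t : measurable (Y @^-1` exceeds t).
  exact: measurable_preimageT mY (measurable_exceeds t).
have mA1 := measurable_preimageT mY mA.
have mA2 := measurable_preimageT (measurable_comp_Bshift h) mA.
under eq_integral do rewrite (indicM (Y @^-1` exceeds h) (Y @^-1` A)).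
under [in RHS]eq_integral do
  rewrite (indicM (Y @^-1` exceeds (- h)) ((Bshift h \o Y) @^-1` A)).
rewrite !integral_indicT; [exact: tc| |]; exact: measurableI.
Qed.

Lemma mass_transport (g : E -> R) : measurable_fun setT g ->
  (forall f, 0 <= g f) ->
  (\int[P]_w ((g (Y w))%:E * BB (Y w)) =
   \int[P]_w (\esum_(t in [set: Zd d])
     ((\1_(exceeds t) (Y w))%:E * (g (Bshift (- t)%R (Y w)))%:E)))%E.
Proof.
move=> mg g0; pose x t w : \bar R := (\1_(exceeds t) (Y w))%:E.
have x0 t w : (0 <= x t w)%E by rewrite lee_fin.
have mx t : measurable_fun setT (x t).
  by apply/measurable_EFinP; exact: measurable_indic_exceeds.
have mgY t : measurable_fun setT (fun w => (g (Bshift t (Y w)))%:E).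
  apply/measurable_EFinP.
  exact: measurableT_comp mg (measurable_comp_Bshift t).
have mgY0 : measurable_fun setT (fun w => (g (Y w))%:E).
  by apply/measurable_EFinP; exact: measurableT_comp mg mY.
rewrite (@integral_esum R (Zd d) _ T P
  (fun t w => x t w * (g (Bshift (- t)%R (Y w)))%:E)%E); last 2 first.
- by move=> t; exact: emeasurable_funM.
- by move=> t w; rewrite mule_ge0 ?lee_fin.
transitivity (\int[P]_w (\esum_(t in [set: Zd d]) ((g (Y w))%:E * x t w)))%E.
  by apply: eq_integral => w _; rewrite BBE -ge0_esumZl.
rewrite (@integral_esum R (Zd d) _ T P
  (fun t w => (g (Y w))%:E * x t w)%E); last 2 first.
- by move=> t; exact: emeasurable_funM.
- by move=> t w; rewrite mule_ge0 ?lee_fin.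
rewrite -esum_opp; apply: eq_esum => t _; under eq_integral do rewrite muleC.
rewrite (@integral_time_change (- t)%R (EFin \o g)) ?opprK//.
exact/measurable_EFinP.
Qed.

Lemma esum_selector (Q : set E) (f : E) : selector Q ->
  \esum_(t in [set: Zd d])
    ((\1_(exceeds t) f)%:E * (\1_Q (Bshift (- t) f))%:E)%E =
  (\1_(seen_from_exceedance Q) f)%:E :> \bar R.
Proof.
move=> sQ; have [[j Qj fj]|nQ] := pselect (seen_from_exceedance Q f).
  rewrite (esum_only1 (j := j))//.
    by rewrite !indicE !mem_set ?mule1//; exists j.
  move=> t _ tj; rewrite [\1_Q _]indicE [in X in (_ * X)%E]memNset ?mule0//.
  by move=> Qt; rewrite (sQ _ _ _ Qt Qj) eqxx in tj.
rewrite [in RHS]indicE memNset// esum1// => t _.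
have [ft|ft] := pselect (1 < f t); last by rewrite indicE memNset ?mul0e.
rewrite [\1_Q _]indicE [in X in (_ * X)%E]memNset ?mule0// => Qt.
by apply: nQ; exists t.
Qed.

Lemma selector_transport (Q : set E) (u : E -> R) :
  measurable Q -> selector Q -> measurable_fun setT u -> (forall f, 0 <= u f) ->
  (forall h f, u (Bshift h f) = u f) ->
  (\int[P]_w ((u (Y w) * \1_Q (Y w))%:E * BB (Y w)) =
   \int[P]_w (u (Y w) * \1_(seen_from_exceedance Q) (Y w))%:E)%E.
Proof.
move=> mQ sQ u_meas u0 uB.
rewrite (mass_transport (g := fun f => u f * \1_Q f)).
- apply: eq_integral => w _; rewrite EFinM -esum_selector// -ge0_esumZl//.
  by apply: eq_esum => t _; rewrite uB -!EFinM mulrCA.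
- by apply: measurable_funM => //; exact: measurable_indic.
- by move=> f; rewrite mulr_ge0.
Qed.

Lemma selector_transport1 (Q : set E) : measurable Q -> selector Q ->
  (\int[P]_w ((\1_Q (Y w))%:E * BB (Y w)) =
   P (Y @^-1` seen_from_exceedance Q))%E.
Proof.
move=> mQ sQ; have := selector_transport mQ sQ (measurable_cst (1 : R)).
move=> /(_ (fun=> ler01) (fun _ _ => erefl)).
under eq_integral do rewrite mul1r.
under [in X in _ = X]eq_integral do rewrite mul1r.
move=> ->; rewrite -integral_indicT//.
exact: measurable_preimageT mY (measurable_seen_from_exceedance mQ).
Qed.

Lemma selector_seen_null (Q : set E) : measurable Q -> selector Q ->
  {ae P, forall w, ~ Q (Y w)} ->
  {ae P, forall w, ~ seen_from_exceedance Q (Y w)}.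
Proof.
move=> mQ sQ nQ.
have mS := measurable_preimageT mY (measurable_seen_from_exceedance mQ).
suff PS : P (Y @^-1` seen_from_exceedance Q) = 0%E.
  exact: measure0_ae_not mS PS.
rewrite -selector_transport1// -(integral0 P setT); apply: ae_eq_integral => //.
- apply: emeasurable_funM; last exact: measurableT_comp measurable_BB mY.
  by apply/measurable_EFinP; exact: measurableT_comp (measurable_indic mQ) mY.
- by apply: filterS nQ => w nQw _; rewrite indicE memNset ?mul0e.
Qed.

Lemma selector_BB_lty (Q : set E) : measurable Q -> selector Q ->
  {ae P, forall w, Q (Y w) -> (BB (Y w) < +oo)%E}.
Proof.
move=> mQ sQ; have mQY := measurable_preimageT mY mQ.
apply: (integral_indic_lty mQY) => [|w|].
- exact: measurableT_comp measurable_BB mY.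
- exact: BB_ge0.
- rewrite selector_transport1//; apply: le_lt_trans (ltry 1).
  apply: probability_le1.
  exact: measurable_preimageT mY (measurable_seen_from_exceedance mQ).
Qed.

Definition expected_inv_BB : \bar R := (\int[P]_w ediv 1 (BB (Y w)))%E.

Lemma probability_selector (Q : set E) : measurable Q -> selector Q ->
  {ae P, forall w, 1 < Y w 0} ->
  {ae P, forall w, (BB (Y w) < +oo)%E -> seen_from_exceedance Q (Y w)} ->
  P (Y @^-1` Q) = expected_inv_BB.
Proof.
move=> mQ sQ Y1 seenQ; have mQY := measurable_preimageT mY mQ.
have minv (A : set E) : measurable A ->
    measurable_fun setT (fun w => (inv_BB (Y w) * \1_A (Y w))%:E).
  move=> mA; apply/measurable_EFinP.
  have minvA : measurable_fun setT (fun f : E => inv_BB f * \1_A f).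
    apply: measurable_funM; first exact: measurable_inv_BB.
    exact: measurable_indic.
  exact: measurableT_comp minvA mY.
transitivity (\int[P]_w ((inv_BB (Y w) * \1_Q (Y w))%:E * BB (Y w)))%E.
  rewrite -integral_indicT//; apply: ge0_ae_eq_integral => //.
  - exact/measurable_EFinP/measurable_indic.
  - apply: emeasurable_funM; first exact: minv.
    exact: measurableT_comp measurable_BB mY.
  - by move=> w _; rewrite mule_ge0 ?BB_ge0// lee_fin mulr_ge0// inv_BB_ge0.
  apply: filterS2 Y1 (selector_BB_lty mQ sQ) => w Y1w QBB _.
  rewrite -[\1_(_ @^-1` _) w]/(\1_Q (Y w)) indicE.
  case: (boolP (Y w \in Q)); rewrite ?mulr0 ?mul0e// inE => /QBB BBy.
  by rewrite mulr1 (inv_BB_mul Y1w BBy).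
rewrite (selector_transport mQ sQ measurable_inv_BB); last 2 first.
- exact: inv_BB_ge0.
- exact: inv_BB_Bshift.
apply: ge0_ae_eq_integral => //.
- by apply: minv; exact: measurable_seen_from_exceedance.
- under eq_fun do rewrite ediv1_BB; apply/measurable_EFinP.
  exact: measurableT_comp measurable_inv_BB mY.
- by move=> w _; rewrite lee_fin mulr_ge0// inv_BB_ge0.
- by move=> w _; rewrite ediv1_BB lee_fin inv_BB_ge0.
apply: filterS seenQ => w seenQw _; rewrite ediv1_BB.
have [/seenQw seen|] := ltP (BB (Y w)) +oo%E.
  by rewrite indicE mem_set// mulr1.
by rewrite leye_eq => /eqP/inv_BB_infty ->; rewrite mul0r.
Qed.

End MassTransport.

(** * Integrating out the Pareto radius *)

Section UnitPareto.
Context {R : realType} {d : measure_display} {T : measurableType d}.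
Context (P : probability T R) (r : T -> R).

Definition unit_pareto :=
  forall x : R, 1 <= x -> P [set w | x < r w] = (x^-1)%:E.

Context (mr : measurable_fun setT r) (pareto : unit_pareto).

Lemma unit_pareto_gt1 : {ae P, forall w, 1 < r w}.
Proof.
apply: probability1_ae; first exact: measurable_ltr_set.
by rewrite pareto// invr1.
Qed.

Lemma unit_pareto_mul_gt1 (m : R) : 0 <= m ->
  P [set w | 1 < r w * m] = (Num.min m 1)%:E.
Proof.
rewrite le_eqVlt => /predU1P[<-|m0].
  rewrite min_l// (_ : [set _ | _] = set0) ?measure0//.
  by apply/seteqP; split => w //=; rewrite mulr0 ltr10.
have -> : [set w | 1 < r w * m] = [set w | m^-1 < r w].
  by apply/seteqP; split => w /=; rewrite -ltr_pdivrMr// mul1r.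
have [m1|m1] := leP m 1; first by rewrite pareto ?invrK// invf_ge1.
rewrite -(probability_setT P); apply: ae_eq_measure => //.
  exact: measurable_ltr_set.
by apply: filterS unit_pareto_gt1 => w /= r1; split => // _;
  rewrite (lt_trans _ r1)// invf_lt1.
Qed.

Lemma unit_pareto_mul_eq1 (m : R) : 0 <= m -> P [set w | r w * m = 1] = 0%E.
Proof.
move=> m0; have mrm c : measurable_fun setT (fun w => r w * c).
  exact: measurable_funM.
have mgt c : measurable [set w | 1 < r w * c] by exact: measurable_ltr_set.
have meq : measurable [set w | r w * m = 1].
  exact: measurable_preimageT (mrm m) (measurable_set1 1).
apply/le_anti; rewrite measure_ge0 andbT; apply/lee_addgt0Pr => e e0.
rewrite add0e.
have em0 : 0 <= (1 + e) * m by rewrite mulr_ge0// addr_ge0// ltW.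
rewrite -(leeD2rE _ _ (probability_fin_num P (mgt m)))//.
rewrite -measureU//; last first.
  by apply/seteqP; split => w //= -[->]; rewrite ltxx.
apply: (@le_trans _ _ (P [set w | 1 < r w * ((1 + e) * m)])).
  apply: le_measure; rewrite ?inE//; first exact: measurableU.
  move=> w /=; rewrite mulrCA => -[->|rm1]; first by rewrite mulr1 ltrDl.
  by rewrite (lt_le_trans rm1)// ler_peMl ?lerDl ?ltW// (lt_trans ltr01).
rewrite !unit_pareto_mul_gt1// -EFinD lee_fin [leRHS]addrC.
have [m1|m1] := leP m 1; last by rewrite ge_min lerDl (ltW e0) orbT.
by rewrite ge_min mulrDl mul1r lerD2l ler_piMr// ltW.
Qed.

End UnitPareto.

Section IndependentPareto.
Context {R : realType} {d1 d2 : measure_display}.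
Context {T : measurableType d1} {E : measurableType d2}.
Context (P : probability T R) (r : T -> R) (X : T -> E).
Context (mr : measurable_fun setT r) (mX : measurable_fun setT X).
Context (pareto : unit_pareto P r) (indep : independent P r X).
Context (m : E -> R) (mm : measurable_fun setT m) (m0 : forall w, 0 <= m (X w)).

Let measurable_mul_m : measurable_fun setT (fun z : R * E => z.1 * m z.2).
Proof.
by apply: measurable_funM => //; exact: measurableT_comp mm measurable_snd.
Qed.

Lemma integral_pareto_mul_gt1 (g : E -> R) :
  measurable_fun setT g -> (forall x, 0 <= g x) ->
  (\int[P]_w ((g (X w))%:E * (\1_[set w | (1 < r w * m (X w))%R] w)%:E) =
   \int[P]_w ((g (X w))%:E * (Num.min (m (X w)) 1)%:E))%E.
Proof.
move=> mg g0; pose A : set (R * E) := [set z | 1 < z.1 * m z.2].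
have mA : measurable A by exact: measurable_ltr_set.
have mF : measurable_fun setT (fun z : R * E => ((g z.2)%:E * (\1_A z)%:E)%E).
  apply: emeasurable_funM; apply/measurable_EFinP; last exact: measurable_indic.
  exact: measurableT_comp mg measurable_snd.
have F0 z : (0 <= (g z.2)%:E * (\1_A z)%:E)%E by rewrite mule_ge0// lee_fin.
transitivity (\int[P]_w \int[P]_v ((g (X w))%:E * (\1_A (r v, X w))%:E))%E.
  exact: (integral_independent mr mX indep mF F0).
apply: eq_integral => w _.
have mAw : measurable [set v | 1 < r v * m (X w)].
  by apply: measurable_ltr_set => //; exact: measurable_funM.
rewrite ge0_integralZl_EFin//;
  last exact/measurable_EFinP/(measurable_indic mAw).
congr (_ * _)%E; rewrite (integral_indicT P mAw).
exact: unit_pareto_mul_gt1.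
Qed.

Lemma probability_pareto_mul_gt1 :
  P [set w | 1 < r w * m (X w)] = (\int[P]_w (Num.min (m (X w)) 1)%:E)%E.
Proof.
rewrite (probability_independent (A := [set z | 1 < z.1 * m z.2]) mr mX)//.
  by apply: eq_integral => w _; exact: (unit_pareto_mul_gt1 mr pareto (m0 w)).
exact: measurable_ltr_set.
Qed.

Lemma probability_pareto_mul_eq1 : P [set w | r w * m (X w) = 1] = 0%E.
Proof.
rewrite (probability_independent (A := [set z | z.1 * m z.2 = 1]) mr mX)//.
  by apply: integral0_eq => w _; exact: (unit_pareto_mul_eq1 mr pareto (m0 w)).
exact: measurable_preimageT measurable_mul_m (measurable_set1 1).
Qed.

End IndependentPareto.

(** * Identities for the tail field *)

Definition tail_rf {R : realType} {T : Type} {d : nat}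
  (r : T -> R) (Theta : T -> Zd d -> R) : T -> Zd d -> R :=
  fun w t => r w * Theta w t.

Lemma measurable_tail_rf {R : realType} {d : nat} {dT : measure_display}
    {T : measurableType dT} (r : T -> R) (Theta : T -> fieldspace R d) :
  measurable_fun setT r -> measurable_fun setT Theta ->
  measurable_fun setT (tail_rf r Theta : T -> fieldspace R d).
Proof.
move=> mr mTheta; apply: measurable_field => t; apply: measurable_funM => //.
exact: measurableT_comp (@measurable_coord R d t) mTheta.
Qed.

Record tail_decomposition {R : realType} {d : nat} {dT : measure_display}
    {T : measurableType dT} (P : probability T R) (r : T -> R)
    (Theta : T -> Zd d -> R) : Prop := TailDecomposition {
  tail_measurable_radius : measurable_fun setT r;
  tail_pareto : unit_pareto P r;
  tail_measurable_Theta : measurable_fun setT (Theta : T -> fieldspace R d);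
  tail_Theta_ge0 : forall w, Defs.inE (Theta w);
  tail_Theta_at0 : {ae P, forall w, Theta w 0 = 1};
  tail_independent : independent P r (Theta : T -> fieldspace R d);
  tail_time_change : time_change P (tail_rf r Theta)
}.

Section TailField.
Context {R : realType} {d : nat} {dT : measure_display} {T : measurableType dT}.
Context (P : probability T R) (r : T -> R) (Theta : T -> Zd d -> R).
Context (tail : tail_decomposition P r Theta).
Local Notation E := (fieldspace R d).
Local Notation Y := (tail_rf r Theta).
Let mr := tail_measurable_radius tail.
Let mTheta := tail_measurable_Theta tail.
Let Theta0 := tail_Theta_ge0 tail.
Let tc := tail_time_change tail.

Lemma measurable_Theta_coord t : measurable_fun setT (fun w => Theta w t).
Proof. exact: measurableT_comp (@measurable_coord R d t) mTheta. Qed.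

Let mY := measurable_tail_rf mr mTheta.

Lemma measurable_BB_tail_rf : measurable_fun setT (fun w => BB (Y w)).
Proof. exact: measurableT_comp measurable_BB mY. Qed.

Lemma measurable_SS_Theta : measurable_fun setT (fun w => SS (Theta w)).
Proof. exact: measurableT_comp measurable_SS mTheta. Qed.

Lemma radius_gt1 : {ae P, forall w, 1 < r w}.
Proof. exact: unit_pareto_gt1 mr (tail_pareto tail). Qed.

Lemma tail_rf_at0_gt1 : {ae P, forall w, 1 < Y w 0}.
Proof.
by apply: filterS2 radius_gt1 (tail_Theta_at0 tail) => w r1 t1;
  rewrite /tail_rf t1 mulr1.
Qed.

Lemma tail_rf_ge0 w : 0 < r w -> Defs.inE (Y w).
Proof. by move=> r0; apply: inE_scale (Theta0 w) (ltW r0). Qed.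

Lemma SS_tail_rf_lty w : 0 < r w ->
  (SS (Y w) < +oo)%E <-> (SS (Theta w) < +oo)%E.
Proof. by move=> r0; exact: SS_scale_lty (Theta0 w) r0. Qed.

Lemma probability_tail_rf_gt1 t :
  P [set w | 1 < Y w t] = (\int[P]_w (Num.min (Theta w t) 1)%:E)%E.
Proof.
exact: (probability_pareto_mul_gt1 mr mTheta (tail_pareto tail)
  (tail_independent tail) (@measurable_coord R d t) (fun w => Theta0 w t)).
Qed.

Lemma tail_rf_neq1 t : {ae P, forall w, Y w t <> 1}.
Proof.
have mYt := measurable_preimageT mY (measurable_coord_eq t 1).
apply: measure0_ae_not mYt _.
exact: (probability_pareto_mul_eq1 mr mTheta (tail_pareto tail)
  (tail_independent tail) (@measurable_coord R d t) (fun w => Theta0 w t)).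
Qed.

Lemma integral_BB_tail_rf (g : E -> R) :
  measurable_fun setT g -> (forall f, 0 <= g f) ->
  (\int[P]_w ((g (Theta w))%:E * BB (Y w)) =
   \int[P]_w ((g (Theta w))%:E *
     \esum_(t in [set: Zd d]) (Num.min (Theta w t) 1)%:E))%E.
Proof.
move=> mg g0; pose x t w : \bar R := (\1_(exceeds t) (Y w))%:E.
pose y t w : \bar R := (Num.min (Theta w t) 1)%:E.
have x0 t w : (0 <= x t w)%E by rewrite lee_fin.
have y0 t w : (0 <= y t w)%E by rewrite lee_fin le_min Theta0 ler01.
have mgT : measurable_fun setT (fun w => (g (Theta w))%:E).
  by apply/measurable_EFinP; exact: measurableT_comp mg mTheta.
under eq_integral do rewrite BBE -ge0_esumZl//.
under [RHS]eq_integral do rewrite -(ge0_esumZl (a := y ^~ _))//.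
rewrite (@integral_esum R (Zd d) _ T P
  (fun t w => (g (Theta w))%:E * x t w)%E); last 2 first.
- move=> t; apply: emeasurable_funM => //; apply/measurable_EFinP.
  exact: measurable_indic_exceeds mY t.
- by move=> t w; rewrite mule_ge0// lee_fin.
rewrite (@integral_esum R (Zd d) _ T P
  (fun t w => (g (Theta w))%:E * y t w)%E); last 2 first.
- move=> t; apply: emeasurable_funM => //; apply/measurable_EFinP.
  by apply: measurable_minr => //; exact: measurable_Theta_coord.
- by move=> t w; rewrite mule_ge0// lee_fin.
apply: eq_esum => t _.
exact: (integral_pareto_mul_gt1 mr mTheta (tail_pareto tail)
  (tail_independent tail) (@measurable_coord R d t) (fun w => Theta0 w t)
  mg g0).
Qed.

Lemma probability_tail_selector (Q : set E) : measurable Q -> selector Q ->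
  {ae P, forall w, (BB (Y w) < +oo)%E -> seen_from_exceedance Q (Y w)} ->
  P [set w | Q (Y w)] = expected_inv_BB P Y.
Proof.
by move=> mQ sQ; exact: (probability_selector mY tc mQ sQ tail_rf_at0_gt1).
Qed.

End TailField.

Section TailIdentities.
Context {R : realType} {d : nat} {dT : measure_display} {T : measurableType dT}.
Context (ord : rel (Zd d)) (ordP : ti_total_order ord).
Context (P : probability T R) (r : T -> R) (Theta : T -> Zd d -> R).
Context (tail : tail_decomposition P r Theta).
Local Notation E := (fieldspace R d).
Local Notation Y := (tail_rf r Theta).
Let mTheta := tail_measurable_Theta tail.
Let mY := measurable_tail_rf (tail_measurable_radius tail) mTheta.
Let Theta0 := tail_Theta_ge0 tail.
Let tc := tail_time_change tail.
Let fmax : set E := [set f | first_max ord f].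
Let mfmax : measurable fmax := measurable_first_max ord.

(* A shift-invariant and 0-homogeneous weight [u] takes the same value at [Y],
   at [Theta] and at all their shifts; at a first maximum of [Theta] all values
   are at most 1, so integrating out the radius turns [BB Y] into [SS Theta]. *)
Lemma first_max_transport (u : E -> R) : measurable_fun setT u ->
  (forall f, 0 <= u f) -> (forall h f, u (Bshift h f) = u f) ->
  (forall f (c : R), Defs.inE f -> 0 < c -> u (fun t => c * f t) = u f) ->
  (\int[P]_w ((u (Theta w) * \1_fmax (Theta w))%:E * SS (Theta w)) =
   \int[P]_w (u (Y w) * \1_(seen_from_exceedance fmax) (Y w))%:E)%E.
Proof.
move=> u_meas u0 uB u_hom; pose g f := u f * \1_fmax f.
have mg : measurable_fun setT (g : E -> R).
  by apply: measurable_funM => //; exact: measurable_indic.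
have g0 f : 0 <= g f by rewrite mulr_ge0.
have mgT : measurable_fun setT (fun w => (g (Theta w))%:E).
  by apply/measurable_EFinP; exact: measurableT_comp mg mTheta.
have mgY : measurable_fun setT (fun w => (g (Y w))%:E).
  by apply/measurable_EFinP; exact: measurableT_comp mg mY.
have mBY := measurable_BB_tail_rf tail.
rewrite -(selector_transport mY tc mfmax (selector_first_max ordP))//.
transitivity (\int[P]_w ((g (Theta w))%:E * BB (Y w)))%E; last first.
  apply: ge0_ae_eq_integral => //; try exact: emeasurable_funM.
  - by move=> w _; rewrite mule_ge0 ?BB_ge0// lee_fin.
  - by move=> w _; rewrite mule_ge0 ?BB_ge0// lee_fin g0.
  apply: filterS (radius_gt1 tail) => w r1 _; have r0 := lt_trans ltr01 r1.
  rewrite /g [in RHS]u_hom//; congr ((_ * _)%:E * _)%E; apply: eq_indic.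
  by apply: iff_sym; exact: first_max_scale.
rewrite (integral_BB_tail_rf tail mg g0); apply: ge0_ae_eq_integral => //.
- by apply: emeasurable_funM => //; exact: (measurable_SS_Theta tail).
- apply: emeasurable_funM => //; apply: measurable_esum => t.
  apply/measurable_EFinP; apply: measurable_minr => //.
  exact: (measurable_Theta_coord tail).
- by move=> w _; rewrite mule_ge0 ?SS_ge0// lee_fin g0.
- move=> w _; rewrite mule_ge0 ?lee_fin// esum_ge0// => t _.
  by rewrite lee_fin le_min Theta0 ler01.
apply: filterS (tail_Theta_at0 tail) => w t1 _; rewrite -/(g _).
have [fm|nfm] := pselect (fmax (Theta w)); last first.
  by rewrite /g indicE memNset ?mulr0 ?mul0e.
congr (_ * _)%E; apply: eq_esum => t _; rewrite min_l//.
by rewrite -t1; have [] := fm t.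
Qed.

Lemma first_max_SS_lty :
  {ae P, forall w, first_max ord (Theta w) -> (SS (Theta w) < +oo)%E}.
Proof.
have mfT := measurable_preimageT mTheta mfmax.
apply: (integral_indic_lty mfT) => [|w|].
- exact: (measurable_SS_Theta tail).
- exact: SS_ge0.
have mS := measurable_preimageT mY (measurable_seen_from_exceedance mfmax).
apply: le_lt_trans (le_lt_trans (probability_le1 P mS) (ltry 1)).
under eq_integral do rewrite -[\1_(_ @^-1` _) _]mul1r.
rewrite (first_max_transport (u := fun=> 1))//.
by under eq_integral do rewrite mul1r; rewrite (integral_indicT P mS).
Qed.

Lemma BB_SS_tail_rf_lty :
  {ae P, forall w, (BB (Y w) < +oo)%E <-> (SS (Y w) < +oo)%E}.
Proof.
pose fmaxy : set E := fmax `\` [set f | (SS f < +oo)%E].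
have mfmaxy : measurable fmaxy := measurableD mfmax measurable_SS_lty.
have sfmaxy : selector fmaxy.
  exact: sub_selector (@subDsetl _ _ _) (selector_first_max ordP).
have null_fmaxy : {ae P, forall w, ~ fmaxy (Y w)}.
  apply: filterS2 (radius_gt1 tail) first_max_SS_lty => w r1 SST [fm Sy].
  have r0 := lt_trans ltr01 r1; apply: Sy => /=.
  exact: (SS_tail_rf_lty tail r0).2 (SST ((first_max_scale _ _ r0).1 fm)).
apply: filterS2 (selector_seen_null mY tc mfmaxy sfmaxy null_fmaxy)
  (tail_rf_at0_gt1 tail) => w unseen Y1.
split; last exact: le_lt_trans (BB_le_SS _).
move=> By; apply: contrapT => Sy; apply: unseen.
have [j fm Yj] := BB_lty_seen_first_max ordP By Y1.
by exists j => //; split => //=; rewrite SS_Bshift.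
Qed.

Lemma probability_first_exceedance :
  P [set w | first_exceedance ord (Y w)] = expected_inv_BB P Y.
Proof.
apply: (probability_tail_selector tail).
- exact: measurable_first_exceedance.
- exact: selector_first_exceedance.
- apply: filterS (tail_rf_at0_gt1 tail) => w Y1 By.
  exact: (BB_lty_seen_first_exceedance ordP By Y1).
Qed.

Lemma probability_anchor_SS_lty (Q : set E) : measurable Q -> selector Q ->
  {ae P, forall w, (SS (Y w) < +oo)%E -> seen_from_exceedance Q (Y w)} ->
  P [set w | Q (Y w) /\ (SS (Y w) < +oo)%E] = expected_inv_BB P Y.
Proof.
move=> mQ sQ seenQ; pose QS : set E := Q `&` [set f | (SS f < +oo)%E].
apply: (probability_tail_selector tail (Q := QS)).
- exact: measurableI mQ measurable_SS_lty.
- exact: sub_selector (@subIsetl _ _ _) sQ.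
- apply: filterS2 BB_SS_tail_rf_lty seenQ => w BS seen /BS Sy.
  by have [j Qj Yj] := seen Sy; exists j => //; split => //=; rewrite SS_Bshift.
Qed.

Lemma probability_I_fe :
  P [set w | I_fe ord (Y w) = Some 0] = expected_inv_BB P Y.
Proof.
rewrite (_ : [set _ | _] =
    [set w | first_exceedance ord (Y w) /\ (SS (Y w) < +oo)%E]); last first.
  by apply/seteqP; split => w /= /(I_fe_eq0 ordP).
apply: probability_anchor_SS_lty.
- exact: measurable_first_exceedance.
- exact: selector_first_exceedance.
- apply: filterS2 (tail_rf_at0_gt1 tail) BB_SS_tail_rf_lty => w Y1 BS /BS.
  by move=> By; exact: (BB_lty_seen_first_exceedance ordP By Y1).
Qed.

Lemma seen_first_max :
  {ae P, forall w, (SS (Y w) < +oo)%E -> seen_from_exceedance fmax (Y w)}.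
Proof.
apply: filterS2 (tail_rf_at0_gt1 tail) BB_SS_tail_rf_lty => w Y1 BS /BS.
by move=> By; exact: (BB_lty_seen_first_max ordP By Y1).
Qed.

Lemma probability_first_max_Theta :
  P [set w | first_max ord (Theta w)] = expected_inv_BB P Y.
Proof.
have sfmax := selector_first_max (R := R) ordP.
have <- := probability_anchor_SS_lty mfmax sfmax seen_first_max.
apply: ae_eq_measure; first exact: measurable_preimageT mTheta mfmax.
  exact: measurable_preimageT mY (measurableI _ _ mfmax measurable_SS_lty).
apply: filterS2 (radius_gt1 tail) first_max_SS_lty => w r1 SST.
have r0 := lt_trans ltr01 r1; have fmYT := first_max_scale ord (Theta w) r0.
split => [fm|[/fmYT]//]; split; first exact/fmYT.
exact/(SS_tail_rf_lty tail r0)/SST.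
Qed.

Lemma probability_I_A :
  P [set w | I_A ord (Theta w) = Some 0] = expected_inv_BB P Y.
Proof.
pose Q0 : set E := fmax `&` ([set f | 0 < f 0] `&` [set f | (SS f < +oo)%E]).
rewrite (_ : [set _ | _] = Theta @^-1` Q0); last first.
  apply/seteqP; split => w /=; first by move=> /(I_A_eq0 ordP (Theta0 w))[].
  by move=> [fm [t0 S]]; exact/(I_A_eq0 ordP (Theta0 w)).
rewrite -probability_first_max_Theta; apply: ae_eq_measure.
- have mpos := @measurable_coord_gt R d 0 0.
  have mQ0 := measurableI _ _ mfmax (measurableI _ _ mpos measurable_SS_lty).
  exact: measurable_preimageT mTheta mQ0.
- exact: measurable_preimageT mTheta mfmax.
apply: filterS2 (tail_Theta_at0 tail) first_max_SS_lty => w t1 SST.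
by split => [[]//|fm]; split => //; split; rewrite /= ?t1//; exact: SST.
Qed.

Lemma integral_sup_over_sum_seen :
  (\int[P]_w (sup_over_sum (Y w) * \1_(seen_from_exceedance fmax) (Y w))%:E =
   \int[P]_w (sup_over_sum (Theta w))%:E)%E.
Proof.
have msup := @measurable_sup_over_sum R d.
apply: ge0_ae_eq_integral => //.
- apply/measurable_EFinP; apply: measurable_funM;
    first exact: measurableT_comp msup mY.
  have mS := measurable_seen_from_exceedance mfmax.
  exact: measurableT_comp (measurable_indic mS) mY.
- by apply/measurable_EFinP; exact: measurableT_comp msup mTheta.
- by move=> w _; rewrite lee_fin mulr_ge0// sup_over_sum_ge0.
- by move=> w _; rewrite lee_fin sup_over_sum_ge0.
apply: filterS2 (radius_gt1 tail) seen_first_max => w r1 seen _.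
rewrite -(sup_over_sum_scale (Theta0 w) (lt_trans ltr01 r1)) -/(Y w).
have [/seen fmY|] := ltP (SS (Y w)) +oo%E;
  first by rewrite indicE mem_set// mulr1.
by rewrite leye_eq => /eqP/sup_over_sum_SS_infty ->; rewrite mul0r.
Qed.

Lemma integral_sup_over_sum_Theta :
  (\int[P]_w ediv (supf (Theta w)) (SS (Theta w)))%E = expected_inv_BB P Y.
Proof.
have msup := @measurable_sup_over_sum R d.
under eq_integral do rewrite ediv_supf_SS.
rewrite -integral_sup_over_sum_seen -(first_max_transport msup); last 3 first.
- exact: sup_over_sum_ge0.
- exact: sup_over_sum_Bshift.
- exact: sup_over_sum_scale.
rewrite -probability_first_max_Theta -integral_indicT; last first.
  exact: measurable_preimageT mTheta mfmax.
apply: ge0_ae_eq_integral => //.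
- apply: emeasurable_funM; last exact: (measurable_SS_Theta tail).
  apply/measurable_EFinP; apply: measurable_funM;
    first exact: measurableT_comp msup mTheta.
  exact: measurableT_comp (measurable_indic mfmax) mTheta.
- by apply/measurable_EFinP;
    exact: measurableT_comp (measurable_indic mfmax) mTheta.
- by move=> w _; rewrite mule_ge0 ?SS_ge0// lee_fin mulr_ge0// sup_over_sum_ge0.
apply: filterS2 (tail_Theta_at0 tail) first_max_SS_lty => w t1 SST _.
have [fm|nfm] := pselect (fmax (Theta w)); last first.
  by rewrite !indicE !memNset ?mulr0 ?mul0e.
rewrite !indicE !mem_set// mulr1 (sup_over_sum_first_max fm) ?t1//.
exact: SST.
Qed.

Section Anchoring.
Context (I : (Zd d -> R) -> option (Zd d)) (anchI : anchoring I).
Context (I_defined : P [set w | I (Y w) <> None /\ (SS (Y w) < +oo)%E] =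
  P [set w | (SS (Y w) < +oo)%E]).

Lemma seen_anchored_at0 :
  {ae P, forall w, (SS (Y w) < +oo)%E ->
    seen_from_exceedance (anchored_at0 I) (Y w)}.
Proof.
have mSome := measurableC (measurable_anchoring_eq anchI None).
have mSomeY := measurable_preimageT mY mSome.
have mSS := measurable_preimageT mY measurable_SS_lty.
have defined := probabilityI_eq_ae mSomeY mSS I_defined.
have neq1 : {ae P, forall w t, Y w t <> 1}.
  by apply: ae_forall_countable => t; exact: (tail_rf_neq1 tail).
have gt1 : {ae P, forall w, 1 < r w /\ 1 < Y w 0}.
  exact: filterI (radius_gt1 tail) (tail_rf_at0_gt1 tail).
apply: filterS2 (filterI defined neq1) gt1.
move=> w [Idef Yneq1] [r1 Y1] /Idef; case Ij : (I (Y w)) => [j|//] _.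
apply: anchoring_seen_from_exceedance (Yneq1 j) Ij => //.
exact: (tail_rf_ge0 tail (lt_trans ltr01 r1)).
Qed.

Lemma probability_anchoring :
  P [set w | I (Y w) = Some 0 /\ (SS (Y w) < +oo)%E] = expected_inv_BB P Y.
Proof.
have mA := measurable_anchored_at0 anchI.
have sA := selector_anchored_at0 anchI.
have <- := probability_anchor_SS_lty mA sA seen_anchored_at0.
have mI0 := measurable_anchoring_eq anchI (Some 0).
have mI := measurableI _ _ mI0 measurable_SS_lty.
apply: ae_eq_measure; first exact: measurable_preimageT mY mI.
  exact: measurable_preimageT mY (measurableI _ _ mA measurable_SS_lty).
apply: filterS (radius_gt1 tail) => w r1.
split => [[I0 Sy]|[[I0 _] Sy]]//; split => //; split => //.
exact: (tail_rf_ge0 tail (lt_trans ltr01 r1)).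
Qed.

Lemma probability_anchoring_Theta : zero_homogeneous I ->
  P [set w | I (Theta w) = Some 0 /\ (SS (Theta w) < +oo)%E] =
    expected_inv_BB P Y.
Proof.
move=> hom; rewrite -probability_anchoring.
have mI0 := measurable_anchoring_eq anchI (Some 0).
have mI := measurableI _ _ mI0 measurable_SS_lty.
apply: ae_eq_measure; first exact: measurable_preimageT mTheta mI.
  exact: measurable_preimageT mY mI.
apply: filterS (radius_gt1 tail) => w r1; have r0 := lt_trans ltr01 r1.
have IYT : I (Y w) = I (Theta w) := hom _ _ (Theta0 w) r0.
by rewrite /= IYT; split => -[I0 /(SS_tail_rf_lty tail r0)].
Qed.

End Anchoring.

End TailIdentities.

Section ExtremalIndexOne.
Context {R : realType} {d : nat} {dT : measure_display} {T : measurableType dT}.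
Context (ord : rel (Zd d)) (ordP : ti_total_order ord).
Context (P : probability T R) (r : T -> R) (Theta : T -> Zd d -> R).
Context (tail : tail_decomposition P r Theta).
Local Notation Y := (tail_rf r Theta).
Let mY := measurable_tail_rf (tail_measurable_radius tail)
  (tail_measurable_Theta tail).

Lemma tail_rf_le1_Theta_eq0 t :
  {ae P, forall w, Y w t <= 1} -> {ae P, forall w, Theta w t = 0}.
Proof.
move=> Yle1; have mYt := measurable_preimageT mY (measurable_exceeds t).
have mmin : measurable_fun setT (fun w => (Num.min (Theta w t) 1)%:E).
  apply/measurable_EFinP; apply: measurable_minr => //.
  exact: (measurable_Theta_coord tail).
have min0 w : (0 <= (Num.min (Theta w t) 1)%:E)%E.
  by rewrite lee_fin le_min (tail_Theta_ge0 tail) ler01.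
have : (\int[P]_w `|(Num.min (Theta w t) 1)%:E| = 0)%E.
  under eq_integral do rewrite gee0_abs//.
  rewrite -(probability_tail_rf_gt1 tail); apply: ae_not_measure0 mYt _.
  by apply: filterS Yle1 => w; rewrite leNgt => /negP.
move=> /(ae_eq_integral_abs P measurableT mmin); apply: filterS => w /(_ I)[].
by rewrite /Num.min; case: ifP => // _ /eqP; rewrite oner_eq0.
Qed.

Lemma first_exceedance_of_inv_BB_eq1 :
  expected_inv_BB P Y = 1%E -> {ae P, forall w, first_exceedance ord (Y w)}.
Proof.
rewrite -(probability_first_exceedance ordP tail); apply: probability1_ae.
exact: measurable_preimageT mY (measurable_first_exceedance ord).
Qed.

Lemma expected_inv_BB_of_Theta_eq0 :
  (forall t, t != 0 -> {ae P, forall w, Theta w t = 0}) ->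
  expected_inv_BB P Y = 1%E.
Proof.
move=> T0; have {}T0 : {ae P, forall w t, t != 0 -> Theta w t = 0}.
  apply: ae_forall_countable => t; have [->|t0] := eqVneq t 0; first exact: aeW.
  by apply: filterS (T0 t t0).
rewrite -(probability_setT P) -integral_indicT//;
  apply: ge0_ae_eq_integral => //.
- under eq_fun do rewrite ediv1_BB; apply/measurable_EFinP.
  exact: measurableT_comp measurable_inv_BB mY.
- exact/measurable_EFinP/measurable_indic.
- by move=> w _; rewrite ediv1_BB lee_fin inv_BB_ge0.
apply: filterS2 (tail_rf_at0_gt1 tail) T0 => w Y1 t0 _.
have BY : BB (Y w) = 1%E.
  rewrite /BB (esum_only1 (j := 0)) ?Y1// => t _ tn0.
  by rewrite /tail_rf t0// mulr0 ltr10.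
by rewrite ediv1_BB /inv_BB BY invr1 indicT.
Qed.

End ExtremalIndexOne.

(* If [0] is the first exceedance both for the order and for its reverse, it is
   the only one. *)
Lemma expected_inv_BB_eq1 {R : realType} {d : nat} {dT : measure_display}
    {T : measurableType dT} (ord : rel (Zd d)) (P : probability T R)
    (r : T -> R) (Theta : T -> Zd d -> R) :
  ti_total_order ord -> tail_decomposition P r Theta ->
  expected_inv_BB P (tail_rf r Theta) = 1%E <->
  forall t, t != 0 -> {ae P, forall w, Theta w t = 0}.
Proof.
move=> ordP tail; split; last exact: expected_inv_BB_of_Theta_eq0.
move=> E1 t t0; apply: (tail_rf_le1_Theta_eq0 tail).
apply: filterS2 (first_exceedance_of_inv_BB_eq1 ordP tail E1)
  (first_exceedance_of_inv_BB_eq1 (ti_total_order_rev ordP) tail E1).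
move=> w [_ before] [_ after]; rewrite leNgt; apply/negP => Yt.
by rewrite (ord_anti ordP (before _ Yt) (after _ Yt)) eqxx in t0.
Qed.

(** * The exponent function *)

Section Orthants.
Context {R : realType} {d : nat}.
Local Notation E := (fieldspace R d).
Implicit Types (s : seq (Zd d * R)) (f : Zd d -> R) (h t : Zd d).

Definition orthant s : set E :=
  [set f | forall p, p \in s -> (f p.1 : R) <= p.2].

Definition max_ratio s f : R := \big[Num.max/0]_(p <- s) (f p.1 / p.2).

Definition positive_levels s := all (fun p => 0 < p.2) s.

Definition shift_levels h s := [seq (p.1 + h, p.2) | p <- s].

Lemma orthant_nil : orthant [::] = setT.
Proof. by apply/seteqP; split. Qed.

Lemma orthant_cons p s :
  orthant (p :: s) = [set f | (f p.1 : R) <= p.2] `&` orthant s.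
Proof.
apply/seteqP; split => [f fps|f [fp fs] q]; last first.
  by rewrite in_cons => /predU1P[->//|]; exact: fs.
by split=> [|q qs]; apply: fps; rewrite in_cons ?eqxx// qs orbT.
Qed.

Lemma orthant_cat s1 s2 : orthant (s1 ++ s2) = orthant s1 `&` orthant s2.
Proof.
elim: s1 => [|p s IH]; first by rewrite orthant_nil setTI.
by rewrite cat_cons !orthant_cons IH setIA.
Qed.

Lemma measurable_orthant s : measurable (orthant s).
Proof.
elim: s => [|p s IH]; first by rewrite orthant_nil.
by rewrite orthant_cons; apply: measurableI => //; exact: measurable_coord_le.
Qed.

Lemma preimage_Bshift_orthant h s :
  (Bshift h : E -> E) @^-1` orthant s = orthant (shift_levels (- h) s).
Proof.
apply/seteqP; split => f fs p; first by move=> /mapP[q qs ->]; exact: fs.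
by move=> ps; apply: (fs (p.1 - h, p.2)); apply/mapP; exists p.
Qed.

Lemma positive_levels_shift h s :
  positive_levels (shift_levels h s) = positive_levels s.
Proof. by rewrite /positive_levels all_map. Qed.

Lemma max_ratio_nil f : max_ratio [::] f = 0.
Proof. by rewrite /max_ratio big_nil. Qed.

Lemma max_ratio_cons p s f :
  max_ratio (p :: s) f = Num.max (f p.1 / p.2) (max_ratio s f).
Proof. by rewrite /max_ratio big_cons. Qed.

Lemma max_ratio_ge0 s f : 0 <= max_ratio s f.
Proof.
elim: s => [|p s IH]; first by rewrite max_ratio_nil.
by rewrite max_ratio_cons le_max IH orbT.
Qed.

Lemma measurable_max_ratio s : measurable_fun setT (max_ratio s : E -> R).
Proof.
elim: s => [|p s IH].
  have -> : max_ratio [::] = fun=> 0 by apply/funext => f;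
    rewrite max_ratio_nil.
  exact: measurable_cst.
have -> : max_ratio (p :: s) = fun f => Num.max (f p.1 / p.2) (max_ratio s f).
  by apply/funext => f; rewrite max_ratio_cons.
by apply: measurable_maxr => //; apply: measurable_funM => //;
  exact: measurable_coord.
Qed.

Lemma max_ratio_le1 s f : positive_levels s ->
  max_ratio s f <= 1 <-> orthant s f.
Proof.
elim: s => [|p s IH] /=; first by rewrite orthant_nil max_ratio_nil ler01.
move=> /andP[p0 /IH{}IH]; rewrite max_ratio_cons orthant_cons ge_max.
by rewrite ler_pdivrMr// mul1r; split => [/andP[fp /IH]|[fp /IH fs]]//;
  apply/andP.
Qed.

Lemma max_ratio_scale s f (c : R) : 0 <= c ->
  max_ratio s (fun t => c * f t) = c * max_ratio s f.
Proof.
move=> c0; elim: s => [|p s IH]; first by rewrite !max_ratio_nil mulr0.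
by rewrite !max_ratio_cons IH maxr_pMr// mulrA.
Qed.

Lemma max_ratio_perm s1 s2 f : perm_eq s1 s2 -> max_ratio s1 f = max_ratio s2 f.
Proof. exact: perm_big. Qed.

End Orthants.

Section OrthantUniqueness.
Context {R : realType} {d : nat}.
Local Notation E := (fieldspace R d).
Implicit Types (s : seq (Zd d * R)) (m : {measure set E -> \bar R}).

Lemma measurable_sigma_orthant (A : set E) : measurable A ->
  <<s [set B : set E | exists s, B = orthant s] >> A.
Proof.
set G := [set B | _]; apply: smallest_sub; first exact: smallest_sigma_algebra.
move=> _ [t [B [mB ->]]].
have : measurable_fun setT (fun f : g_sigma_algebraType G => (f t : R)).
  apply: (measurability _ (RGenOInfty.measurableE R)) => _ [_ [x ->] <-].
  rewrite setTI (_ : _ @^-1` _ = ~` orthant [:: (t, x)]).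
    by apply: measurableC; apply: sub_sigma_algebra; exists [:: (t, x)].
  rewrite orthant_cons orthant_nil setIT.
  by apply/seteqP; split => f /=; rewrite in_itv/= andbT ltNge => /negP.
by move=> /(_ measurableT _ mB); rewrite setTI.
Qed.

Lemma measure_orthant_unique m1 m2 : (m1 setT < +oo)%E ->
  (forall s, m1 (orthant s) = m2 (orthant s)) ->
  forall A : set E, measurable A -> m1 A = m2 A.
Proof.
move=> m1y eqm A /measurable_sigma_orthant.
apply: (@g_sigma_algebra_measure_unique _ _ E _ _ (fun=> orthant [::])) => //.
- by move=> _ [s ->]; exact: measurable_orthant.
- by move=> _; exists [::].
- by rewrite orthant_nil bigcup_const.
- by move=> _ _ [s1 ->] [s2 ->]; exists (s1 ++ s2); rewrite orthant_cat.
- by move=> _ [s ->].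
- by move=> _; rewrite orthant_nil.
Qed.

Definition raise_levels s n := [seq (p.1, p.2 + n.+1%:R^-1) | p <- s].

Lemma bigcap_orthant_raise s : \bigcap_n orthant (raise_levels s n) = orthant s.
Proof.
apply/seteqP; split => f fs; last first.
  move=> n _ _ /mapP[p ps ->] /=; apply: le_trans (fs p ps) _.
  by rewrite lerDl invr_ge0.
move=> p ps; apply/ler_addgt0Pr => e e0.
have [n _ /(_ n (leqnn _)) ne] := near_infty_natSinv_lt (PosNum e0).
have /le_trans := fs n I _ (map_f (fun p => (p.1, p.2 + n.+1%:R^-1)) ps); apply.
by rewrite /= lerD2l ltW.
Qed.

Lemma orthant_raise_nonincreasing s :
  {homo orthant \o raise_levels s : n m / (n <= m)%N >-> (m <= n)%O}.
Proof.
move=> n k nk; apply/subsetPset => f fk _ /mapP[p ps ->] /=.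
have /le_trans := fk _ (map_f (fun p => (p.1, p.2 + k.+1%:R^-1)) ps); apply.
by rewrite /= lerD2l lef_pV2 ?posrE ?ltr0n// ler_nat ltnS.
Qed.

Lemma cvg_measure_orthant_raise m s : (m setT < +oo)%E ->
  m (orthant (raise_levels s n)) @[n --> \oo] --> m (orthant s).
Proof.
move=> my; rewrite -bigcap_orthant_raise.
apply: (@nonincreasing_cvg_mu _ _ _ m (orthant \o raise_levels s)) => //.
- by apply: le_lt_trans my; apply: le_measure; rewrite ?inE//;
    exact: measurable_orthant.
- by move=> n; exact: measurable_orthant.
- by rewrite bigcap_orthant_raise; exact: measurable_orthant.
- exact: orthant_raise_nonincreasing.
Qed.

Lemma measure_orthant_negative m s p : m (~` [set f | Defs.inE f]) = 0%E ->
  p \in s -> p.2 < 0 -> m (orthant s) = 0%E.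
Proof.
move=> m0 ps p0; have minE := measurableC (@measurable_inE R d).
apply: (subset_measure0 (measurable_orthant s) minE _ m0).
move=> f /(_ p ps) fp /(_ p.1).
by rewrite leNgt (le_lt_trans fp p0).
Qed.

Lemma measure_inE_unique m1 m2 :
  (m1 setT < +oo)%E -> (m2 setT < +oo)%E ->
  m1 (~` [set f | Defs.inE f]) = 0%E -> m2 (~` [set f | Defs.inE f]) = 0%E ->
  (forall s, positive_levels s -> m1 (orthant s) = m2 (orthant s)) ->
  forall A : set E, measurable A -> m1 A = m2 A.
Proof.
move=> m1y m2y m10 m20 eqm; apply: measure_orthant_unique => // s.
have [/allP s0|/allPn[p ps]] := boolP (all (fun p => 0 <= p.2) s); last first.
  by rewrite -ltNge => p0; rewrite !(measure_orthant_negative _ ps p0).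
have raise_pos n : positive_levels (raise_levels s n).
  rewrite /positive_levels all_map; apply/allP => p ps /=.
  by rewrite ltr_wpDl ?s0// invr_gt0 ltr0n.
have := cvg_measure_orthant_raise (s := s) m1y.
under eq_fun do rewrite eqm//.
by move=> /cvg_lim <-//; apply: cvg_lim => //; exact: cvg_measure_orthant_raise.
Qed.

End OrthantUniqueness.

Record tail_exponent {R : realType} {d : nat} {dT : measure_display}
    {T : measurableType dT} (P : probability T R) (Y : T -> Zd d -> R)
    (V : seq (Zd d * R) -> R) : Prop := TailExponent {
  exponent_nil : V [::] = 0;
  exponent_perm : forall s1 s2, perm_eq s1 s2 -> V s1 = V s2;
  exponent_shift : forall h s, positive_levels s -> V (shift_levels h s) = V s;
  exponent_orthant : forall s, positive_levels s ->
    P (Y @^-1` orthant s) = (V ((0, 1) :: s) - V s)%:E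
}.

Section TimeChange.
Context {R : realType} {d : nat} {dT : measure_display} {T : measurableType dT}.
Local Notation E := (fieldspace R d).
Context (P : probability T R) (Y : T -> Zd d -> R) (V : seq (Zd d * R) -> R).
Context (mY : measurable_fun setT (Y : T -> E)).
Context (Y_ge0 : {ae P, forall w, Defs.inE (Y w)}).
Context (Vtail : tail_exponent P Y V).

Lemma probability_orthant_exceeds s h : positive_levels s ->
  P (Y @^-1` (orthant s `&` exceeds h)) =
  (V ((0, 1) :: s) - V s - (V ((0, 1) :: (h, 1) :: s) - V ((h, 1) :: s)))%:E.
Proof.
move=> s0; have mo u := measurable_preimageT mY (measurable_orthant u).
have -> : Y @^-1` (orthant s `&` exceeds h) =
    Y @^-1` orthant s `\` Y @^-1` orthant ((h, 1) :: s).
  rewrite orthant_cons; apply/seteqP; split => w [Ys].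
    by rewrite /exceeds /= ltNge => /negP Yh; split => // -[].
  by move=> nYh; split => //; rewrite /exceeds /= ltNge; apply/negP => Yh;
    exact: nYh.
rewrite measureD//; last exact: le_lt_trans (probability_le1 P (mo s)) (ltry 1).
rewrite -preimage_setI orthant_cons setICA setIid -orthant_cons.
rewrite EFinB; congr (_ - _)%E; first exact: (exponent_orthant Vtail s0).
by apply: (exponent_orthant Vtail (s := (h, 1) :: s)); rewrite /= ltr01.
Qed.

Lemma time_change_tail_exponent : time_change P Y.
Proof.
move=> h A mA.
have mexc t := measurable_preimageT mY (@measurable_exceeds R d t).
have mB := measurable_comp_Bshift mY h.
pose m1 := pushforward (mrestr P (mexc h)) (Y : T -> E).
pose m2 := pushforward (mrestr P (mexc (- h))) (Bshift h \o Y : T -> E).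
have mlt t : (P (setT `&` Y @^-1` exceeds t) < +oo)%E.
  by apply: le_lt_trans (probability_le1 P _) (ltry 1); exact: measurableI.
have null_inE (F : T -> E) (mF : measurable_fun setT F) t :
    {ae P, forall w, Defs.inE (F w)} ->
    P (F @^-1` (~` [set f | Defs.inE f]) `&` Y @^-1` exceeds t) = 0%E.
  have mFinE := measurable_preimageT mF (measurableC (@measurable_inE R d)).
  move=> F0; apply: ae_not_measure0; first exact: measurableI.
  by apply: filterS F0 => w Fw [].
apply: (@measure_inE_unique R d m1 m2) => //; try exact: mlt.
- exact: null_inE.
- by apply: null_inE => //; apply: filterS Y_ge0 => w; exact: inE_Bshift.
move=> s s0; rewrite /m1 /m2 /= /pushforward /mrestr.
rewrite -!preimage_setI.
rewrite -[X in _ = P (X `&` _)]/(Y @^-1` (Bshift h @^-1` orthant s)).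
rewrite preimage_Bshift_orthant -preimage_setI.
rewrite !probability_orthant_exceeds ?positive_levels_shift//.
have shift_cons t u : (t, 1) :: shift_levels (- h) u =
  shift_levels (- h) ((t + h, 1) :: u).
  by rewrite /= addrK.
rewrite !shift_cons !(exponent_shift Vtail)//= ?ltr01// add0r addNr.
rewrite (exponent_perm Vtail (s1 := (h, 1) :: (0, 1) :: s)
  (s2 := (0, 1) :: (h, 1) :: s)).
  by congr EFin; ring.
by apply/permP => a /=; rewrite addnCA.
Qed.

End TimeChange.

Lemma tail_decomposition_of_exponent {R : realType} {d : nat}
    {dT : measure_display} {T : measurableType dT} (P : probability T R)
    (r : T -> R) (Theta : T -> Zd d -> R) (V : seq (Zd d * R) -> R) :
  measurable_fun setT r -> unit_pareto P r ->
  measurable_fun setT (Theta : T -> fieldspace R d) ->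
  (forall w, Defs.inE (Theta w)) -> {ae P, forall w, Theta w 0 = 1} ->
  independent P r (Theta : T -> fieldspace R d) ->
  tail_exponent P (tail_rf r Theta) V -> tail_decomposition P r Theta.
Proof.
move=> mr pareto mTheta Theta0 Theta1 indep Vtail; split => //.
apply: (time_change_tail_exponent (measurable_tail_rf mr mTheta) _ Vtail).
apply: filterS (unit_pareto_gt1 mr pareto) => w r1.
exact: inE_scale (Theta0 w) (ltW (lt_trans ltr01 r1)).
Qed.

Section MaxStable.
Context {R : realType} {d : nat} {d1 d2 : measure_display}.
Context {T1 : measurableType d1} {T2 : measurableType d2}.
Context (P1 : probability T1 R) (P2 : probability T2 R).
Context (X : T1 -> Zd d -> R) (Z : T2 -> Zd d -> R).

Definition exponent (s : seq (Zd d * R)) : R :=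
  fine (\int[P2]_w (max_ratio s (Z w))%:E)%E.

Lemma exponent_nil_eq0 : exponent [::] = 0.
Proof.
by rewrite /exponent; under eq_integral do rewrite max_ratio_nil;
  rewrite integral0.
Qed.

Lemma exponent_perm_eq s1 s2 : perm_eq s1 s2 -> exponent s1 = exponent s2.
Proof.
move=> s12; congr fine; apply: eq_integral => w _.
by rewrite (max_ratio_perm _ s12).
Qed.

Context (XZ : forall (n : nat) (t : 'I_n -> Zd d) (x : 'I_n -> R),
  (forall i, 0 < x i) ->
  (- ln (fine (P1 [set w | forall i, X w (t i) <= x i])))%:E
    = (\int[P2]_w (\big[Num.max/0]_(i < n) (Z w (t i) / x i))%:E)%E).

Lemma integral_max_ratio s : positive_levels s ->
  (\int[P2]_w (max_ratio s (Z w))%:E =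
   (- ln (fine (P1 (X @^-1` orthant s))))%:E)%E.
Proof.
move=> /allP s0; pose p := tnth (in_tuple s).
transitivity (\int[P2]_w
  (\big[Num.max/0]_(i < size s) (Z w (p i).1 / (p i).2))%:E)%E.
  by apply: eq_integral => w _; rewrite /max_ratio big_tnth.
rewrite -(XZ (fun i => (p i).1) (x := fun i => (p i).2)); last first.
  by move=> i; apply: s0; exact: mem_tnth.
congr (- ln (fine (P1 _)))%:E; apply/seteqP; split => w /= Xs.
  by move=> q /(tnthP (in_tuple s))[i ->]; exact: Xs.
by move=> i; apply: Xs; exact: mem_tnth.
Qed.

Lemma exponentE s : positive_levels s ->
  (\int[P2]_w (max_ratio s (Z w))%:E = (exponent s)%:E)%E.
Proof. by move=> s0; rewrite /exponent integral_max_ratio. Qed.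

Context (Xstat : forall (h : Zd d) (A : set (Zd d -> R)), prodF A ->
  P1 [set w | A (X w)] = P1 [set w | A (Bshift h (X w))]).

Lemma exponent_shift_levels h s : positive_levels s ->
  exponent (shift_levels h s) = exponent s.
Proof.
move=> s0; rewrite /exponent !integral_max_ratio ?positive_levels_shift//=.
have := Xstat (- h) (measurable_orthant s).
rewrite -[X in _ = P1 X -> _]/(X @^-1` (Bshift (- h) @^-1` orthant s)).
by rewrite preimage_Bshift_orthant opprK => <-.
Qed.

End MaxStable.

Section SpectralTail.
Context {R : realType} {d : nat} {d2 d3 : measure_display}.
Context {T2 : measurableType d2} {T3 : measurableType d3}.
Context (P2 : probability T2 R) (P3 : probability T3 R).
Context (Z : T2 -> Zd d -> R) (Theta : T3 -> Zd d -> R).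
Local Notation E := (fieldspace R d).
Context (mZ : measurable_fun setT (Z : T2 -> E)) (Z0 : forall w t, 0 <= Z w t).
Context (mTheta : measurable_fun setT (Theta : T3 -> E)).
Context (ThetaZ : forall A : set (Zd d -> R), prodF A ->
  P3 [set w | A (Theta w)]
    = (\int[P2]_w (Z w 0 * \1_A (fun t => Z w t / Z w 0))%:E)%E).

Let mZt t : measurable_fun setT (fun w => Z w t).
Proof. exact: measurableT_comp (@measurable_coord R d t) mZ. Qed.

Lemma integral_spectral_tail (G : E -> \bar R) : measurable_fun setT G ->
  (forall f, 0 <= G f)%E ->
  (\int[P3]_w G (Theta w) =
   \int[P2]_w ((Z w 0%R)%:E * G (fun t => (Z w t / Z w 0)%R)))%E.
Proof.
move=> mG G0; under eq_integral do rewrite -[G _]mul1e.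
apply: (eq_integral_weighted (z1 := fun=> 1)
  (F2 := fun w => (fun t => Z w t / Z w 0) : E)) => //.
  apply: measurable_field => t; apply: measurable_funM => //.
  exact: measurableT_comp invr_measurable (mZt 0).
move=> A mA; under eq_integral do rewrite mul1e.
rewrite (integral_indicT P3 (measurable_preimageT mTheta mA)).
by rewrite [LHS](ThetaZ mA); apply: eq_integral => w _; rewrite EFinM.
Qed.

Lemma integral_sup_over_sum_spectral_tail :
  (\int[P3]_w ediv (supf (Theta w)) (SS (Theta w)) =
   \int[P2]_w ((Z w 0%R)%:E * ediv (supf (Z w)) (SS (Z w))))%E.
Proof.
under eq_integral do rewrite ediv_supf_SS.
under [RHS]eq_integral do rewrite ediv_supf_SS.
rewrite (integral_spectral_tail (G := fun f => (sup_over_sum f)%:E));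
  last 2 first.
- by apply/measurable_EFinP; exact: measurable_sup_over_sum.
- by move=> f; rewrite lee_fin sup_over_sum_ge0.
apply: eq_integral => w _; have := Z0 w 0.
rewrite le_eqVlt => /predU1P[<-|z0]; first by rewrite !mul0e.
under [X in sup_over_sum X]eq_fun do rewrite mulrC.
by rewrite sup_over_sum_scale// invr_gt0.
Qed.

Lemma spectral_tail_at0 : (\int[P2]_w (Z w 0)%:E = 1)%E ->
  {ae P3, forall w, Theta w 0 = 1}.
Proof.
move=> EZ; pose A : set E := [set f | (f 0 : R) = 1].
have mA : measurable A := measurable_coord_eq 0 1.
apply: (probability1_ae (A := Theta @^-1` A));
  first exact: measurable_preimageT mTheta mA.
rewrite [LHS](ThetaZ mA) -EZ; apply: eq_integral => w _; congr EFin.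
have [->|z0] := eqVneq (Z w 0) 0; first by rewrite mul0r.
by rewrite indicE mem_set ?mulr1// /A /= divff.
Qed.

Context (r : T3 -> R) (mr : measurable_fun setT r) (pareto : unit_pareto P3 r).
Context (indep : independent P3 r (Theta : T3 -> E)).

Lemma probability_radius_max_ratio s :
  P3 [set w | 1 < r w * max_ratio s (Theta w)] =
  (\int[P2]_w (Num.min (max_ratio s (Z w)) (Z w 0))%:E)%E.
Proof.
rewrite (probability_pareto_mul_gt1 mr mTheta pareto indep
  (measurable_max_ratio s) (fun w => max_ratio_ge0 s (Theta w))).
rewrite (integral_spectral_tail
  (G := fun f => (Num.min (max_ratio s f) 1)%:E)); last 2 first.
- apply/measurable_EFinP; apply: measurable_minr => //.
  exact: measurable_max_ratio.
- by move=> f; rewrite lee_fin le_min max_ratio_ge0 ler01.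
apply: eq_integral => w _; rewrite -EFinM; have := Z0 w 0.
rewrite le_eqVlt => /predU1P[<-|z0];
  first by rewrite mul0r min_r// max_ratio_ge0.
under [X in max_ratio _ X]eq_fun do rewrite mulrC.
rewrite max_ratio_scale ?invr_ge0 ?ltW// minr_pMr ?ltW//.
by rewrite mulrA divff ?gt_eqF// mul1r mulr1.
Qed.

Context (EZ : (\int[P2]_w (Z w 0)%:E = 1)%E).
Context (V : seq (Zd d * R) -> R).
Context (EV : forall s, positive_levels s ->
  (\int[P2]_w (max_ratio s (Z w))%:E = (V s)%:E)%E).

Lemma integral_min_max_ratio s : positive_levels s ->
  (\int[P2]_w (Num.min (max_ratio s (Z w)) (Z w 0))%:E =
   (V s + 1 - V ((0, 1) :: s))%:E)%E.
Proof.
move=> s0; have s01 : positive_levels ((0, 1) :: s) by rewrite /= ltr01.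
have mms u : measurable_fun setT (fun w => max_ratio u (Z w)).
  exact: measurableT_comp (measurable_max_ratio u) mZ.
have mmin : measurable_fun setT (fun w => Num.min (max_ratio s (Z w)) (Z w 0)).
  exact: measurable_minr.
apply/eqP; rewrite EFinB eq_sym sube_eq//; last by rewrite fin_num_adde_defl.
rewrite EFinD -!EV// -EZ -!ge0_integralD//; try exact/measurable_EFinP;
  try by move=> w _; rewrite lee_fin ?le_min ?max_ratio_ge0 ?Z0.
apply/eqP/eq_integral => w _; rewrite -!EFinD max_ratio_cons /= divr1 maxC.
by rewrite [in RHS]addrC addr_max_min.
Qed.

Lemma probability_tail_rf_orthant s : positive_levels s ->
  P3 (tail_rf r Theta @^-1` orthant s) = (V ((0, 1) :: s) - V s)%:E.
Proof.
move=> s0; have mrT : measurable [set w | 1 < r w * max_ratio s (Theta w)].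
  apply: measurable_ltr_set => //; apply: measurable_funM => //.
  exact: measurableT_comp (measurable_max_ratio s) mTheta.
have mY := measurable_tail_rf mr mTheta.
transitivity (P3 (~` [set w | 1 < r w * max_ratio s (Theta w)])).
  apply: ae_eq_measure; last 1 first.
  - apply: filterS (unit_pareto_gt1 mr pareto) => w r1 /=.
    rewrite -(max_ratio_le1 _ s0) max_ratio_scale;
      last exact: ltW (lt_trans ltr01 r1).
    by rewrite leNgt; split => /negP.
  - exact: measurable_preimageT mY (measurable_orthant s).
  - exact: measurableC.
rewrite probability_setC//.
rewrite probability_radius_max_ratio integral_min_max_ratio//.
by rewrite -EFinB; congr EFin; ring.
Qed.

End SpectralTail.

(** * The extremal index *)

Section FirstExceedanceCount.
Context {R : realType} {d : nat} {dT : measure_display} {T : measurableType dT}.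
Context (ord : rel (Zd d)) (ordP : ti_total_order ord).
Local Notation E := (fieldspace R d).
Context (P : probability T R) (Y : T -> Zd d -> R) (V : seq (Zd d * R) -> R).
Context (mY : measurable_fun setT (Y : T -> E)) (Vtail : tail_exponent P Y V).
Implicit Types (s : seq (Zd d)) (t k : Zd d) (D : set (Zd d)).

Definition none_earlier D : set E :=
  [set f | forall k, D k -> ~~ ord 0 k -> (f k : R) <= 1].

Definition prob_none_earlier D : R := fine (P (Y @^-1` none_earlier D)).

Lemma measurable_none_earlier D : measurable (Y @^-1` none_earlier D).
Proof.
apply: measurable_preimageT mY _; rewrite (_ : none_earlier D =
    \bigcap_(k in [set k | D k /\ ~~ ord 0 k]) [set f : E | f k <= 1]).
  by apply: measurable_bigcap_countable => k _; exact: measurable_coord_le.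
apply/seteqP; split => f fD k; first by move=> [Dk k0]; exact: fD.
by move=> Dk k0; exact: (fD k).
Qed.

Lemma prob_none_earlierE D :
  (prob_none_earlier D)%:E = P (Y @^-1` none_earlier D).
Proof.
by rewrite fineK// fin_num_measure//; exact: measurable_none_earlier.
Qed.

Lemma prob_none_earlier_ge0 D : 0 <= prob_none_earlier D.
Proof. by rewrite fine_ge0. Qed.

Lemma prob_none_earlier_le1 D : prob_none_earlier D <= 1.
Proof.
rewrite -lee_fin prob_none_earlierE; apply: probability_le1.
exact: measurable_none_earlier.
Qed.

Lemma le_prob_none_earlier D1 D2 :
  (forall k, D1 k -> ~~ ord 0 k -> D2 k) ->
  prob_none_earlier D2 <= prob_none_earlier D1.
Proof.
move=> D12; rewrite -lee_fin !prob_none_earlierE.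
apply: le_measure; rewrite ?inE; [exact: measurable_none_earlier..|].
by move=> w Yw k Dk k0; apply: Yw => //; exact: D12.
Qed.

Lemma eq_prob_none_earlier D1 D2 : (forall k, ~~ ord 0 k -> D1 k <-> D2 k) ->
  prob_none_earlier D1 = prob_none_earlier D2.
Proof.
move=> D12; apply/le_anti/andP.
by split; apply: le_prob_none_earlier => k + k0; rewrite (D12 k k0).
Qed.

Lemma probability_first_exceedance_none_earlier : {ae P, forall w, 1 < Y w 0} ->
  P [set w | first_exceedance ord (Y w)] = (prob_none_earlier setT)%:E.
Proof.
move=> Y1; rewrite prob_none_earlierE; apply: ae_eq_measure.
- exact: measurable_preimageT mY (measurable_first_exceedance ord).
- exact: measurable_none_earlier.
apply: filterS Y1 => w Y1; split => [[_ fe] k _ k0|ne].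
  by rewrite leNgt; apply: contra k0; exact: fe.
by split=> // k Yk; apply: contraLR Yk => k0; rewrite -leNgt; exact: ne.
Qed.

Definition cube (m : nat) : set (Zd d) := [set k | forall i, `|k i| <= m%:Z].

Lemma cvg_prob_none_earlier_cube :
  prob_none_earlier (cube m) @[m --> \oo] --> prob_none_earlier setT.
Proof.
apply: fine_cvg; rewrite prob_none_earlierE.
have mne m := measurable_none_earlier (cube m).
have -> : Y @^-1` none_earlier setT = \bigcap_m (Y @^-1` none_earlier (cube m)).
  apply/seteqP; split => [w Yw m _ k _|w Yw k _ k0]; first exact: Yw.
  apply: (Yw (\sum_i `|k i|%N)%N) => // i.
  by rewrite -abszE lez_nat (bigD1 i)//= leq_addr.
apply: nonincreasing_cvg_mu => //.
- exact: le_lt_trans (probability_le1 P (mne 0)) (ltry 1).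
- exact: bigcapT_measurable.
- move=> n m nm; apply/subsetPset => w Yw k nk; apply: Yw => i.
  by apply: le_trans (nk i) _; rewrite lez_nat.
Qed.

Definition unit_levels s : seq (Zd d * R) := [seq (t, 1) | t <- s].

Lemma positive_unit_levels s : positive_levels (unit_levels s).
Proof. by rewrite /positive_levels all_map; apply/allP => t _ /=. Qed.

Definition window s t : set (Zd d) := [set k | k + t \in s].

Lemma none_earlier_window s t : (forall u, u \in s -> ~~ ord t u) ->
  none_earlier (window s t) = orthant (shift_levels (- t) (unit_levels s)).
Proof.
move=> earlier; apply/seteqP; split => f fs.
  move=> _ /mapP[_ /mapP[u us ->] ->] /=.
  by apply: fs; rewrite /window /= ?subrK// (ord0B ordP); exact: earlier.
move=> k ks k0; apply: (fs (k, 1)); apply/mapP; exists (k + t, 1);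
  last by rewrite addrK.
by apply/mapP; exists (k + t).
Qed.

Lemma exponent_unit_cons t s : (forall u, u \in s -> ~~ ord t u) ->
  V (unit_levels (t :: s)) = V (unit_levels s) + prob_none_earlier (window s t).
Proof.
move=> earlier; rewrite /prob_none_earlier none_earlier_window//.
have ps := positive_unit_levels s; have pts := positive_unit_levels (t :: s).
rewrite (exponent_orthant Vtail) ?positive_levels_shift//=.
rewrite -[(0, 1) :: _]/((0, 1) :: shift_levels (- t) (unit_levels s))
  -(subrr t).
rewrite -[(t - t, 1) :: _]/(shift_levels (- t) (unit_levels (t :: s))).
by rewrite !(exponent_shift Vtail)// addrC subrK.
Qed.

Lemma exponent_unit_sorted s : sorted (fun x y => ord y x) s -> uniq s ->
  V (unit_levels s) = \sum_(t <- s) prob_none_earlier (window s t).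
Proof.
case: (ordP) => rf anti tr tot _.
have rev_tr : transitive (fun x y => ord y x).
  by move=> y x z xy yz; exact: tr yz xy.
elim: s => [_ _|t s IH /= ts_sorted /andP[ts s_uniq]].
  by rewrite big_nil (exponent_nil Vtail).
have le_t u : u \in s -> ord u t.
  by move=> us; have /allP/(_ u us) := order_path_min rev_tr ts_sorted.
have nle_t u : u \in s -> ~~ ord t u.
  by move=> us; apply: contra ts => tu; rewrite (anti t u)// tu le_t.
rewrite exponent_unit_cons// big_cons addrC IH//;
  last exact: path_sorted ts_sorted.
congr (_ + _).
  apply: eq_prob_none_earlier => k k0; rewrite /window /= in_cons.
  split=> [->|/predU1P[ktt|//]]; rewrite ?orbT//.
  by rewrite -(addrK t k) ktt subrr rf in k0.
rewrite big_seq [RHS]big_seq; apply: eq_bigr => u us;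
  apply: eq_prob_none_earlier => k k0.
rewrite /window /= in_cons; split=> [->|/predU1P[kut|//]]; rewrite ?orbT//.
by rewrite -(addrK u k) kut (ord0B ordP) le_t in k0.
Qed.

Lemma exponent_unit_sum s : uniq s ->
  V (unit_levels s) = \sum_(t <- s) prob_none_earlier (window s t).
Proof.
case: (ordP) => _ _ tr tot _ s_uniq; pose s' := sort (fun x y => ord y x) s.
have s's : perm_eq s' s by rewrite perm_sort.
rewrite -(exponent_perm Vtail (perm_map (fun t => (t, 1)) s's)).
rewrite exponent_unit_sorted ?sort_uniq//; last first.
  by apply: sort_sorted => x y; exact: tot.
rewrite (perm_big _ s's) /=; apply: eq_bigr => t _;
  apply: eq_prob_none_earlier => k _.
by rewrite /window /= mem_sort.
Qed.

End FirstExceedanceCount.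

Section Box.
Context {d : nat}.

Definition box_point n (g : {ffun 'I_d -> 'I_n.+1}) : Zd d :=
  [ffun k => (g k : nat)%:Z].

Definition box_seq n : seq (Zd d) :=
  [seq box_point g | g : {ffun 'I_d -> 'I_n.+1}].

Lemma box_point_inj n : injective (@box_point n).
Proof.
move=> g h /ffunP gh; apply/ffunP => k; apply/val_inj.
by have := gh k; rewrite !ffunE => -[].
Qed.

Lemma uniq_box_seq n : uniq (box_seq n).
Proof. by rewrite map_inj_uniq ?enum_uniq//; exact: box_point_inj. Qed.

Lemma mem_box_seq n t : (t \in box_seq n) <-> @box d n t.
Proof.
split => [/mapP[g _ ->] k|bt].
  by rewrite ffunE; split=> //; rewrite lez_nat -ltnS ltn_ord.
apply/mapP; exists [ffun k => inord `|t k|%N]; first by rewrite mem_enum.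
apply/ffunP => k; rewrite !ffunE; have [t0 tn] := bt k.
by rewrite inordK ?gez0_abs// ltnS -lez_nat gez0_abs.
Qed.

Definition box_interior m n (g : {ffun 'I_d -> 'I_n.+1}) :=
  [forall k, (m <= g k)%N && (g k + m <= n)%N].

Lemma cube_box_interior m n g k : @box_interior m n g -> cube m k ->
  k + box_point g \in box_seq n.
Proof.
move=> /forallP ig mk; apply/mem_box_seq => i; rewrite !ffunE.
have /andP[] := ig i; have := mk i; rewrite ler_norml => /andP[].
by move: (nat_of_ord (g i)) (k i) => b a; split; lia.
Qed.

Lemma card_interior_interval m n :
  (n.+1 - m.*2 <= #|[pred j : 'I_n.+1 | (m <= j)%N && (j + m <= n)%N]|)%N.
Proof.
pose h (i : 'I_(n.+1 - m.*2)) : 'I_n.+1 := inord (i + m)%N.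
have hE i : h i = (i + m)%N :> nat.
  by rewrite inordK//; have := ltn_ord i; lia.
have h_inj : injective h.
  by move=> i j /(congr1 (@nat_of_ord _)); rewrite !hE => /addIn/val_inj.
rewrite -[leqLHS]card_ord -(card_codom h_inj); apply: subset_leq_card.
apply/fintype.subsetP => _ /codomP[i ->]; rewrite inE hE.
by have := ltn_ord i; lia.
Qed.

Lemma card_box_interior m n :
  ((n.+1 - m.*2) ^ d <= #|[pred g | @box_interior m n g]|)%N.
Proof.
pose A := [pred j : 'I_n.+1 | (m <= j)%N && (j + m <= n)%N].
apply: (@leq_trans (#|A| ^ d)%N).
  by case: (posnP d) => [->|d0];
    rewrite ?expn0// leq_exp2r// card_interior_interval.
rewrite -[X in (_ ^ X)%N](card_ord d) -card_ffun_on; apply: subset_leq_card.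
apply/fintype.subsetP => g /ffun_onP gA; rewrite inE; apply/forallP => k.
exact: gA.
Qed.

Lemma ereal_sup_box {R : realType} n (f : Zd d -> R) : Defs.inE f ->
  ereal_sup [set (f t)%:E | t in @box d n] =
  (max_ratio (unit_levels (box_seq n)) f)%:E.
Proof.
move=> f0; rewrite /max_ratio big_map.
apply/le_anti/andP; split.
  apply: ge_ereal_sup => _ [t /mem_box_seq tb <-]; rewrite lee_fin.
  rewrite -[f t]divr1.
  exact: (le_bigmax_seq 0 t xpredT (fun u => f u / 1) tb).
pose upper x := (x%:E <= ereal_sup [set (f t)%:E | t in @box d n])%E.
rewrite big_seq; apply: (big_ind upper) => [|x y|t /mem_box_seq tb].
- apply: le_trans (ereal_sup_ubound _); last by exists 0 => // k; rewrite ffunE.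
  by rewrite lee_fin.
- by rewrite /upper EFin_max ge_max => -> ->.
- by rewrite /upper divr1; apply: ereal_sup_ubound; exists t.
Qed.

End Box.

Lemma cvg_shifted_ratio_expn {R : realType} (d : nat) (c : R) :
  ((n%:R + c) / n%:R) ^+ d @[n --> \oo] --> (1 : R).
Proof.
have inv0 : (n%:R : R)^-1 @[n --> \oo] --> (0 : R).
  apply/gtr0_cvgV0; last exact: cvgr_idn.
  by near=> n; rewrite ltr0n; near: n; exact: nbhs_infty_gt.
have ratio1 : 1 + c * (n%:R)^-1 @[n --> \oo] --> (1 : R).
  rewrite -[X in _ --> X]addr0 -[X in _ --> _ + X](mulr0 c).
  by apply: cvgD; [exact: cvg_cst|apply: cvgM => //; exact: cvg_cst].
rewrite -[X in _ --> X](expr1n _ d).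
have ratio1d : (1 + c * n%:R^-1) ^+ d @[n --> \oo] --> (1 : R) ^+ d.
  exact: (cvg_comp (fun n : nat => 1 + c * n%:R^-1) (fun x : R => x ^+ d) ratio1
    (@exprn_continuous R d 1)).
apply: cvg_trans ratio1d; apply: near_eq_cvg; near=> n.
rewrite mulrDl divff// pnatr_eq0 -lt0n; near: n; exact: nbhs_infty_gt.
Unshelve. all: by end_near.
Qed.

Section ExtremalIndex.
Context {R : realType} {d : nat} {dT : measure_display} {T : measurableType dT}.
Context (ord : rel (Zd d)) (ordP : ti_total_order ord).
Local Notation E := (fieldspace R d).
Context (P : probability T R) (Y : T -> Zd d -> R) (V : seq (Zd d * R) -> R).
Context (mY : measurable_fun setT (Y : T -> E)) (Vtail : tail_exponent P Y V).

Local Notation prob_none_earlier := (prob_none_earlier ord P Y).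
Local Notation exponent_box n := (V (unit_levels (box_seq n))).

Lemma exponent_box_sum n : exponent_box n =
  \sum_(g : {ffun 'I_d -> 'I_n.+1})
    prob_none_earlier (window (box_seq n) (box_point g)).
Proof.
by rewrite (exponent_unit_sum ordP mY Vtail (uniq_box_seq n)) big_map big_enum.
Qed.

Lemma exponent_box_ge n :
  n.+1%:R ^+ d * prob_none_earlier setT <= exponent_box n.
Proof.
rewrite exponent_box_sum -natrX -[X in (X ^ _)%N](card_ord n.+1)
  -[X in (_ ^ X)%N](card_ord d).
rewrite -card_ffun mulr_natl -sumr_const.
by apply: ler_sum => g _; exact: le_prob_none_earlier.
Qed.

(* A point of the box at distance at least [m] from the boundary contributes at
   most [prob_none_earlier (cube m)], the other points at most 1. *)
Lemma exponent_box_le m n : exponent_box n <=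
  n.+1%:R ^+ d * prob_none_earlier (cube m) +
  (n.+1%:R ^+ d - (n.+1 - m.*2)%:R ^+ d).
Proof.
rewrite exponent_box_sum.
apply: (@le_trans _ _ (\sum_(g : {ffun 'I_d -> 'I_n.+1})
    (prob_none_earlier (cube m) + (1 - (@box_interior d m n g)%:R)))).
  apply: ler_sum => g _; have [ig|_] := boolP (box_interior m g).
    rewrite subrr addr0; apply: le_prob_none_earlier => // k mk _.
    exact: cube_box_interior ig mk.
  rewrite subr0 (le_trans (prob_none_earlier_le1 _ _ mY _))// lerDr.
  exact: prob_none_earlier_ge0.
rewrite big_split /= sumrB !sumr_const card_ffun !card_ord -natrX mulr_natl.
rewrite lerD2l natrX lerD2l lerN2 -natr_sum -natrX ler_nat.
apply: leq_trans (card_box_interior m n) _.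
rewrite -sum1_card big_mkcond /=; apply: leq_sum => g _.
by rewrite inE; case: box_interior.
Qed.

Let lower n : R := ((n%:R + 1) / n%:R) ^+ d * prob_none_earlier setT.

Let upper m n : R := ((n%:R + 1) / n%:R) ^+ d * prob_none_earlier (cube m) +
  (((n%:R + 1) / n%:R) ^+ d - ((n%:R + (1 - m.*2%:R)) / n%:R) ^+ d).

Lemma cvg_exponent_box_lower : lower n @[n --> \oo] --> prob_none_earlier setT.
Proof.
rewrite -[X in _ --> X]mul1r.
by apply: cvgM; [exact: cvg_shifted_ratio_expn|exact: cvg_cst].
Qed.

Lemma cvg_exponent_box_upper m :
  upper m n @[n --> \oo] --> prob_none_earlier (cube m).
Proof.
rewrite -[X in _ --> X]addr0 -[X in _ --> X + _]mul1r.
rewrite -[X in _ --> _ + X](subrr 1).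
apply: cvgD; last by apply: cvgB; exact: cvg_shifted_ratio_expn.
by apply: cvgM; [exact: cvg_shifted_ratio_expn|exact: cvg_cst].
Qed.

Lemma exponent_box_bounds m n : (0 < n)%N -> (m.*2 <= n)%N ->
  lower n <= n%:R ^- d * exponent_box n <= upper m n.
Proof.
move=> n0 mn; have nd0 : 0 < (n%:R ^+ d : R) by rewrite exprn_gt0// ltr0n.
have nS : n.+1%:R = n%:R + 1 :> R by rewrite natr1.
have nB : (n.+1 - m.*2)%:R = n%:R + (1 - m.*2%:R) :> R.
  by rewrite natrB ?(leqW mn)// nS addrA.
rewrite /lower /upper !expr_div_n ![_ / _ * _]mulrAC -mulrBl -mulrDl.
rewrite ![n%:R ^- d * _]mulrC !ler_pM2r ?invr_gt0// -nS -nB.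
by rewrite exponent_box_ge exponent_box_le.
Qed.

Lemma cvg_exponent_box :
  n%:R ^- d * exponent_box n @[n --> \oo] --> prob_none_earlier setT.
Proof.
apply/cvgrPdist_le => e e0; have e2 : 0 < e / 2 by rewrite divr_gt0.
have [m qm] : exists m,
    prob_none_earlier (cube m) <= prob_none_earlier setT + e / 2.
  have /cvgrPdist_le/(_ _ e2)[m _ /(_ m (leqnn m)) /=] :=
    cvg_prob_none_earlier_cube (ord := ord) (P := P) mY.
  by rewrite distrC => /ler_distlDr ?; exists m.
have /cvgrPdist_le/(_ _ e0) near_lower := cvg_exponent_box_lower.
have /cvgrPdist_le/(_ _ e2) near_upper := @cvg_exponent_box_upper m.
near=> n.
have n0 : (0 < n)%N by near: n; exact: nbhs_infty_gt.
have mn : (m.*2 <= n)%N by near: n; exact: nbhs_infty_ge.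
have /andP[lo hi] := exponent_box_bounds n0 mn.
have : `|prob_none_earlier setT - lower n| <= e by near: n.
have : `|prob_none_earlier (cube m) - upper m n| <= e / 2 by near: n.
rewrite /= !ler_norml => /andP[u1 u2] /andP[l1 l2].
apply/andP; split; lra.
Unshelve. all: by end_near.
Qed.

Lemma extremal_index_first_exceedance
    {dS : measure_display} {S : measurableType dS}
    (Q : probability S R) (Z : S -> Zd d -> R) :
  (forall w, Defs.inE (Z w)) ->
  (forall s, positive_levels s ->
    (\int[Q]_w (max_ratio s (Z w))%:E = (V s)%:E)%E) ->
  {ae P, forall w, 1 < Y w 0} ->
  extremal_index_is Q Z (P [set w | first_exceedance ord (Y w)]).
Proof.
move=> Z0 EV Y1; rewrite (probability_first_exceedance_none_earlier _ mY Y1).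
have EVbox n :
    (\int[Q]_w ereal_sup [set (Z w t)%:E | t in @box d n] =
      (exponent_box n)%:E)%E.
  rewrite -EV ?positive_unit_levels//.
  by apply: eq_integral => w _; exact: ereal_sup_box.
rewrite /extremal_index_is; under eq_fun do rewrite EVbox -EFinM.
by apply: cvg_EFin cvg_exponent_box; near=> n.
Unshelve. all: by end_near.
Qed.

End ExtremalIndex.

Theorem theorem3p4 (R : realType) (d : nat) (ord : rel (Zd d))
  (d1 d2 d3 : measure_display)
  (T1 : measurableType d1) (T2 : measurableType d2) (T3 : measurableType d3)
  (P1 : probability T1 R) (P2 : probability T2 R) (P3 : probability T3 R)
  (X : T1 -> Zd d -> R) (Z : T2 -> Zd d -> R)
  (Theta : T3 -> Zd d -> R) (Rp : T3 -> R)
  (I : (Zd d -> R) -> option (Zd d)) :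
  (* the fixed translation-invariant total order on Z^d *)
  ti_total_order ord ->
  (* X is a random field on (T1, P1) *)
  (forall t, measurable_fun setT (fun w => X w t)) ->
  (* X is stationary *)
  (forall (h : Zd d) (A : set (Zd d -> R)), prodF A ->
     P1 [set w | A (X w)] = P1 [set w | A (Bshift h (X w))]) ->
  (* Z is a spectral random field on (T2, P2) *)
  (forall t, measurable_fun setT (fun w => Z w t)) ->
  (forall w t, 0 <= Z w t) ->
  (forall t, (\int[P2]_w (Z w t)%:E = 1)%E) ->
  P2 [set w | (0 < supf (Z w))%E] = 1%E ->
  (* X is max-stable with spectral random field Z *)
  (forall (n : nat) (t : 'I_n -> Zd d) (x : 'I_n -> R), (forall i, 0 < x i) ->
     (- ln (fine (P1 [set w | forall i, X w (t i) <= x i])))%:E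
       = (\int[P2]_w (\big[Num.max/0]_(i < n) (Z w (t i) / x i))%:E)%E) ->
  (* Theta (on (T3, P3)) is the spectral tail random field *)
  (forall t, measurable_fun setT (fun w => Theta w t)) ->
  (forall w t, 0 <= Theta w t) ->
  (forall A : set (Zd d -> R), prodF A ->
     P3 [set w | A (Theta w)]
       = (\int[P2]_w (Z w 0 * \1_A (fun t => Z w t / Z w 0))%:E)%E) ->
  (* Rp is unit Pareto, independent of Theta *)
  measurable_fun setT Rp ->
  (forall x : R, 1 <= x -> P3 [set w | x < Rp w] = (x^-1)%:E) ->
  (forall (B : set R) (A : set (Zd d -> R)), measurable B -> prodF A ->
     P3 [set w | B (Rp w) /\ A (Theta w)]
       = (P3 [set w | B (Rp w)] * P3 [set w | A (Theta w)])%E) ->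
  (* I is an anchoring map with P(I(Y) in Z^d, S(Y) < oo) = P(S(Y) < oo) *)
  anchoring I ->
  let Y := fun w t => Rp w * Theta w t in
  P3 [set w | I (Y w) <> None /\ (SS (Y w) < +oo)%E]
    = P3 [set w | (SS (Y w) < +oo)%E] ->
  let EinvB := (\int[P3]_w ediv 1 (BB (Y w)))%E in
  (* theta_X = E[1/B(Y)] holds in general *)
  extremal_index_is P2 Z EinvB /\
  ((0 < P3 [set w | (SS (Theta w) < +oo)%E])%E ->
     extremal_index_is P2 Z (P3 [set w | I (Y w) = Some 0 /\ (SS (Y w) < +oo)%E]) /\
     P3 [set w | I (Y w) = Some 0 /\ (SS (Y w) < +oo)%E]
       = P3 [set w | I_fe ord (Y w) = Some 0] /\
     P3 [set w | I_fe ord (Y w) = Some 0]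
       = P3 [set w | I_A ord (Theta w) = Some 0] /\
     P3 [set w | I_A ord (Theta w) = Some 0]
       = (\int[P3]_w ediv (supf (Theta w)) (SS (Theta w)))%E /\
     (\int[P3]_w ediv (supf (Theta w)) (SS (Theta w)))%E
       = (\int[P2]_w ((Z w 0)%:E * ediv (supf (Z w)) (SS (Z w))))%E /\
     (\int[P2]_w ((Z w 0)%:E * ediv (supf (Z w)) (SS (Z w))))%E = EinvB /\
     (zero_homogeneous I ->
        extremal_index_is P2 Z
          (P3 [set w | I (Theta w) = Some 0 /\ (SS (Theta w) < +oo)%E]))) /\
  P3.-negligible [set w | ~ ((BB (Y w) < +oo)%E <-> (SS (Y w) < +oo)%E)] /\
  (extremal_index_is P2 Z 1%E <->
     forall i : Zd d, i != 0 -> {ae P3, forall w, Theta w i = 0}).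
Proof.
move=> ordP _ Xstat mZt Z0 EZ _ XZ mThetat Theta0 ThetaZ mr pareto indep.
move=> anchI Y I_defined EinvB.
rewrite -[Y]/(tail_rf Rp Theta) in I_defined EinvB *.
have mZ : measurable_fun setT (Z : T2 -> fieldspace R d).
  exact: measurable_field.
have mTheta : measurable_fun setT (Theta : T3 -> fieldspace R d).
  exact: measurable_field.
have EV := exponentE XZ.
have Vtail : tail_exponent P3 (tail_rf Rp Theta) (exponent P2 Z).
  split; [exact: exponent_nil_eq0|exact: exponent_perm_eq| |].
    exact: (exponent_shift_levels XZ Xstat).
  exact: (probability_tail_rf_orthant mZ Z0 mTheta ThetaZ mr pareto indep
    (EZ 0) EV).
have Theta1 := spectral_tail_at0 mTheta ThetaZ (EZ 0).
have tail := tail_decomposition_of_exponent mr pareto mTheta Theta0 Theta1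
  indep Vtail.
have EI : extremal_index_is P2 Z EinvB.
  rewrite -[EinvB](probability_first_exceedance ordP tail).
  exact: (extremal_index_first_exceedance ordP
    (measurable_tail_rf mr mTheta) Vtail Z0 EV (tail_rf_at0_gt1 tail)).
split => //; split; [move=> _|split].
- rewrite (probability_anchoring ordP tail anchI I_defined).
  rewrite (probability_I_fe ordP tail) (probability_I_A ordP tail).
  rewrite -(integral_sup_over_sum_spectral_tail mZ Z0 mTheta ThetaZ).
  rewrite (integral_sup_over_sum_Theta ordP tail); do !split=> //; move=> hom.
  by rewrite (probability_anchoring_Theta ordP tail anchI I_defined hom).
- exact: (BB_SS_tail_rf_lty ordP tail).
- rewrite -(expected_inv_BB_eq1 ordP tail); split => [E1|<-//].
  exact: cvg_unique EI E1.
Qed.
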